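(* Let $M$ be any homology manifold (with boundary) with vanishing reduced homology. Then there exists a homology ball that contains $M$ as a full-dimensional subcomplex of its boundary.
   Context: A pure $d$-dimensional polyhedral complex is a homology manifold (with boundary) if for every nonempty face $F$ the reduced homology of its link is either identically zero or that of the sphere $S^{d-\dim F-1}$; its boundary is the subcomplex of faces whose links do not have sphere homology. A homology ball is a homology manifold $B$ with boundary such that the inclusion-induced map $\pi_1(\partial B)\to\pi_1(B)$ is surjective and $B$ has the homology of a ball, i.e. $\tilde H_*(B)=0$. Full-dimensional means of the same dimension as the boundary. *)

(* Defs.v *)
From HB Require Import structures.
From mathcomp Require Import freeg.
From mathcomp Require Import all_boot all_order all_algebra.
From mathcomp Require Import all_classical all_reals all_analysis.
Import Order.TTheory GRing.Theory Num.Theory.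
Import numFieldTopology.Exports numFieldNormedType.Exports.

Set Implicit Arguments.
Unset Strict Implicit.
Unset Printing Implicit Defensive.

Local Open Scope classical_set_scope.
Local Open Scope ring_scope.

Section StdSimplex.
Context {R : realType}.

(* Indexed by the number [j] of vertices: [stdsimplex j] is the simplex usually
   written Delta^(j-1), and [stdsimplex 0] is empty. *)
Definition stdsimplex (j : nat) : set 'rV[R]_j :=
  [set x | (forall i, 0 <= x 0 i) /\ \sum_i x 0 i = 1].
Arguments stdsimplex : clear implicits.

Definition insert0 (j : nat) (i : 'I_j.+1) (x : 'rV[R]_j) : 'rV[R]_j.+1 :=
  \row_k (if unlift i k is Some k' then x 0 k' else 0).

Lemma insert0_stdsimplex (j : nat) (i : 'I_j.+1) (x : 'rV[R]_j) :
  stdsimplex j x -> stdsimplex j.+1 (insert0 i x).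
Proof.
move=> [x0 x1]; split => [k|].
  by rewrite mxE; case: unliftP => // *; exact: x0.
rewrite (bigD1_ord i)//= mxE unlift_none add0r -[RHS]x1.
by apply: eq_bigr => k _; rewrite mxE liftK.
Qed.

Definition face_map (j : nat) (i : 'I_j.+1) (x : stdsimplex j) :
    stdsimplex j.+1 :=
  SigSub (mem_set (insert0_stdsimplex i (set_mem (valP x)))).

Lemma insert0_continuous (j : nat) (i : 'I_j.+1) : continuous (@insert0 j i).
Proof.
move=> x A [P Px sPA].
exists (fun _ k => P 0 (lift i k)) => [i0 k|y Py /=].
  by rewrite (ord1 i0); have := Px 0 (lift i k); rewrite mxE liftK.
apply: sPA => i0 k; rewrite ord1 mxE; case: unliftP => [k' ->|->].
  exact: Py.
by apply: nbhs_singleton; have := Px 0 i; rewrite mxE unlift_none.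
Qed.

Lemma face_map_continuous (j : nat) (i : 'I_j.+1) : continuous (@face_map j i).
Proof.
apply: continuous_comp_initial => x.
apply: (@continuous_comp _ _ _ set_val (@insert0 j i)).
  exact: initial_continuous.
exact: insert0_continuous.
Qed.

HB.instance Definition _ (j : nat) (i : 'I_j.+1) :=
  isContinuous.Build _ _ (@face_map j i) (@face_map_continuous j i).

End StdSimplex.
Arguments stdsimplex : clear implicits.

Section SingularHomology.
Variables (R : realType) (X : topologicalType).

Local Notation simplex j := (continuousType (stdsimplex R j) X).

(* As [stdsimplex R 0] is empty, [chain 0] is a copy of Z and [bdry : chain 1 ->
   chain 0] is the augmentation: with degrees shifted by one, this is the
   augmented singular chain complex with integer coefficients. *)
Definition chain (j : nat) : Type := {freeg (simplex j) / int}.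

Definition bdry (j : nat) : chain j.+1 -> chain j :=
  fglift (fun s : simplex j.+1 =>
    \sum_(i < j.+1) << (-1) ^+ i *g (s \o face_map i : simplex j) >> : chain j).

Lemma bdry_additive (j : nat) : additive (@bdry j).
Proof. exact: lift_is_additive. Qed.

HB.instance Definition _ (j : nat) :=
  GRing.isAdditive.Build (chain j.+1) (chain j) (@bdry j) (@bdry_additive j).

Definition cycles (j : nat) : {pred chain j} :=
  match j return {pred chain j} with
  | 0 => predT
  | j'.+1 => fun c => @bdry j' c == 0
  end.
Arguments cycles : clear implicits.

Lemma cycles_zmod_closed (j : nat) : zmod_closed (cycles j).
Proof.
case: j => [|j]; first by split.
split => [|x y]; rewrite !unfold_in; first by rewrite raddf0.
by move=> /eqP x0 /eqP y0; rewrite raddfB/= x0 y0 subrr.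
Qed.

HB.instance Definition _ (j : nat) :=
  GRing.isZmodClosed.Build (chain j) (cycles j) (@cycles_zmod_closed j).

Definition cycle (j : nat) : Type := {c : chain j | c \in cycles j}.

HB.instance Definition _ (j : nat) := SubChoice.on (cycle j).
HB.instance Definition _ (j : nat) :=
  [SubChoice_isSubZmodule of cycle j by <:].

Definition boundaries (j : nat) : {pred cycle j} :=
  fun z => `[< exists b : chain j.+1, \val z = bdry b >].
Arguments boundaries : clear implicits.

Lemma boundaries_zmod_closed (j : nat) : zmod_closed (boundaries j).
Proof.
split => [|x y]; first by apply/asboolP; exists 0; rewrite !raddf0.
move=> /asboolP[b xb] /asboolP[c yc]; apply/asboolP; exists (b - c).
by rewrite !raddfB/= xb yc.
Qed.

HB.instance Definition _ (j : nat) :=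
  GRing.isZmodClosed.Build (cycle j) (boundaries j) (@boundaries_zmod_closed j).

(* The reduced singular homology group of [X] in degree j - 1. *)
Definition rhomology (j : nat) : Type := Quotient.quot (boundaries j).

Definition acyclic := forall (j : nat) (h : rhomology j), h = 0.

(* [X] has the homology of S^(k-1): Z in degree k - 1, and 0 in all other
   degrees; the sphere S^(-1) is empty. *)
Definition sphere_homology (k : nat) :=
  (exists f : {additive rhomology k -> int}, bijective f) /\
  forall (j : nat) (h : rhomology j), j != k -> h = 0.

End SingularHomology.
Arguments cycles : clear implicits.
Arguments boundaries : clear implicits.

Section FundamentalGroup.
Variables (R : realType) (T : topologicalType).
Implicit Types (A B : set T) (a : T).

Local Notation I := (`[0, 1]%classic : set R).

Definition loop_in A a (g : R -> T) :=
  [/\ {within I, continuous g}, (forall t, I t -> A (g t)),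
      g 0 = a & g 1 = a].

Definition loop_homotopic_in A a (g g' : R -> T) :=
  exists H : R * R -> T,
  [/\ {within I `*` I, continuous H},
      (forall p, (I `*` I) p -> A (H p)),
      (forall t, I t -> H (0, t) = g t /\ H (1, t) = g' t) &
      forall s, I s -> H (s, 0) = a /\ H (s, 1) = a].

Definition pi1_surjective A B :=
  forall a, A a -> forall g, loop_in B a g ->
  exists2 g', loop_in A a g' & loop_homotopic_in B a g' g.

End FundamentalGroup.

Section Polyhedral.
Variables (R : realType) (n : nat).
Local Notation E := 'rV[R]_n.
Implicit Types (F G P : set E).

Definition dotp (u v : E) : R := \sum_i u 0 i * v 0 i.

Definition conv_hull (s : seq E) : set E :=
  [set x | exists w : 'I_(size s) -> R,
    [/\ forall i, 0 <= w i, \sum_i w i = 1 & x = \sum_i w i *: s`_i]].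

Definition polytope P := exists s : seq E, P = conv_hull s.

(* With c = 0, both P and the empty set are faces of P. *)
Definition is_face F P := exists (c : E) (b : R),
  (forall x, P x -> dotp c x <= b) /\ F = P `&` [set x | dotp c x = b].

(* P contains k + 1 affinely independent points. *)
Definition affinely_free P (k : nat) :=
  exists x (A : 'M[R]_(k, n)),
    [/\ P x, (forall i, P (x + row i A)) & row_free A].

(* The dimension of a nonempty polytope (it is 0 on the empty one). *)
Definition dim P : nat := \max_(k < n.+1 | `[< affinely_free P k >]) k.

Record polycomplex := PolyComplex {
  cells : set (set E);
  cells_finite : finite_set cells;
  cells_polytope : forall P, cells P -> polytope P;
  cells_empty : cells set0;
  cells_face : forall F P, cells P -> is_face F P -> cells F;
  cells_meet : forall P Q, cells P -> cells Q ->
    is_face (P `&` Q) P /\ is_face (P `&` Q) Q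
}.

Definition underlying (C : set (set E)) : set E := \bigcup_(F in C) F.

Definition pure (C : set (set E)) (d : nat) := forall F, C F ->
  (dim F <= d)%N /\ exists G, [/\ C G, F `<=` G, G !=set0 & dim G = d].

(* The spherical link of a nonempty face F: the unit vectors orthogonal to F that
   point from F into a cell containing F.  Since v is pointing into G from some
   point of F if and only if it does so from every relative interior point of
   F, there is no need to choose such a point. *)
Definition link (C : set (set E)) F : set E :=
  [set v | [/\ dotp v v = 1, (forall x y, F x -> F y -> dotp v (x - y) = 0) &
    exists G, [/\ C G, F `<=` G &
      exists x t, [/\ F x, 0 < t & G (x + t *: v)]]]].

Definition homology_manifold (C : polycomplex) (d : nat) :=
  pure (cells C) d /\
  forall F, cells C F -> F !=set0 ->
    acyclic R (link (cells C) F) \/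
    sphere_homology R (link (cells C) F) (d - dim F)%N.

(* The empty face belongs to every subcomplex. *)
Definition boundary (C : polycomplex) (d : nat) : set (set E) :=
  [set F | cells C F /\
    (F !=set0 -> ~ sphere_homology R (link (cells C) F) (d - dim F)%N)].

Definition vanishing_homology (C : polycomplex) :=
  acyclic R (underlying (cells C)).

(* If the boundary is not connected, surjectivity on fundamental groups is
   required at each base point. *)
Definition homology_ball (C : polycomplex) (d : nat) :=
  [/\ homology_manifold C d,
      pi1_surjective R (underlying (boundary C d)) (underlying (cells C)) &
      vanishing_homology C].

Definition subcomplex (D C : set (set E)) :=
  D `<=` C /\ forall F G, D G -> is_face F G -> D F.

Definition has_dim (C : set (set E)) (k : nat) :=
  (exists F, [/\ C F, F !=set0 & dim F = k]) /\
  (forall F, C F -> (dim F <= k)%N).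

Definition full_dim_subcomplex (D C : set (set E)) :=
  subcomplex D C /\ exists k, has_dim D k /\ has_dim C k.

End Polyhedral.

(* The collection C viewed in R^(n+m) along the standard inclusion of R^n. *)
Definition embed (R : realType) (n m : nat) (C : set (set 'rV[R]_n)) :
    set (set 'rV[R]_(n + m)) :=
  [set (fun x : 'rV[R]_n => row_mx x (0 : 'rV[R]_m)) @` F | F in C].
Arguments embed {R n} m C.

(* Main.v *)
(* Take [B] to be the cone over [M]: put [M] in the hyperplane [x_(n+1) = 0] and
   join it to the apex [(0, 1)].  As [B] is star-shaped about the apex, it is
   acyclic and simply connected, so only the links matter.  A face of the base
   [M] has a link that can be contracted towards the apex, hence acyclic; the
   link of the apex is homeomorphic to [M], which is acyclic by hypothesis; and
   the link of the pyramid over a face [F] is homeomorphic to the link of [F] in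
   [M].  So [B] is a homology manifold, and its boundary contains all of [M] but
   no pyramid over a top-dimensional face of [M]. *)

(* Acyclicity of the cone and of the links of base faces comes from one criterion, [star_acyclic]: a
   chain contraction by coning towards a point [p]. It involves a set [X], a set [D] containing the
   segments from [p] to [X], and a map [N] from [D] to [X] that fixes [X]. For the cone, [N] is the
   identity. The link of a base face lies on a sphere, and segments leave it, so there [N] is
   normalization. The obstacle is that a link consists of unit vectors orthogonal to its face. The
   direction from a point of [F] to the apex is in general not orthogonal to [F], and a link vector
   of [F] is in general not orthogonal to the pyramid over [F]. Both are corrected with the point
   [z] of the affine hull of [F] closest to the origin, which is also the foot of the perpendicular
   from the apex. A top-dimensional face of [M] has empty link. Since the empty space has reduced
   homology Z in degree -1, this link is not acyclic, so the manifold condition makes it spherical;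
   hence the pyramid over such a face is not in the boundary. *)
From HB Require Import structures.
From mathcomp Require Import freeg.
From Pilot Require Import Defs.
From mathcomp Require Import all_boot all_order all_algebra.
From mathcomp Require Import zify ring lra.
From mathcomp Require Import all_classical all_reals all_analysis.
From mathcomp Require Import generic_quotient ring_quotient.
Import Order.TTheory GRing.Theory Num.Theory.
Import numFieldTopology.Exports numFieldNormedType.Exports.
Import Pilot.Defs.

Set Implicit Arguments.
Unset Strict Implicit.
Unset Printing Implicit Defensive.

Local Open Scope classical_set_scope.
Local Open Scope ring_scope.

(** * Singular homology *)

Section SingularChains.
Variable R : realType.
Implicit Types X Y : topologicalType.

Local Notation simplex X j := (continuousType (stdsimplex R j) X).
Local Notation chain X j := (chain R X j).

(** Identities between additive maps on chains thus need checking on single simplices only. *)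
Lemma chain_ind X j (P : chain X j -> Prop) : P 0 ->
  (forall x y, P x -> P y -> P (x - y)) ->
  (forall s : simplex X j, P << s >>) -> forall c, P c.
Proof.
move=> P0 PB Pg c.
have PN x : P x -> P (- x) by move=> Px; rewrite -sub0r; exact: PB.
have PD x y : P x -> P y -> P (x + y).
  by move=> Px Py; rewrite -[y]opprK; apply: PB => //; exact: PN.
rewrite -[c]freeg_sumE; apply: (big_ind P) => // s _.
have PM n : P (<< s >> *+ n).
  by elim: n => [|n IHn]; rewrite ?mulr0n // mulrS; exact: PD.
have -> : << coeff s c *g s >> = << s >> *~ coeff s c :> chain X j.
  by rewrite freegU_mulz intz.
by case: (coeff s c) => n; [exact: PM | rewrite NegzE mulrNz; apply/PN/PM].
Qed.

Lemma bdryU X j (s : simplex X j.+1) : bdry (<< s >> : chain X j.+1) =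
  \sum_(i < j.+1) << (-1) ^+ i *g (s \o face_map i : simplex X j) >>.
Proof. by rewrite /bdry liftU scale1r. Qed.

Lemma freegU_sign X j (k : int) (s : simplex X j) :
  << k *g s >> = << s >> *~ k :> chain X j.
Proof. by rewrite freegU_mulz intz. Qed.

Definition push X Y (f : continuousType X Y) j : chain X j -> chain Y j :=
  fglift (fun s : simplex X j => << (f \o s : simplex Y j) >> : chain Y j).

Lemma push_additive X Y (f : continuousType X Y) j : additive (@push X Y f j).
Proof. exact: lift_is_additive. Qed.

HB.instance Definition _ X Y (f : continuousType X Y) j :=
  GRing.isAdditive.Build (chain X j) (chain Y j) (@push X Y f j)
    (@push_additive X Y f j).

Lemma pushU X Y (f : continuousType X Y) j (s : simplex X j) :
  push f << s >> = << (f \o s : simplex Y j) >>.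
Proof. by rewrite /push liftU scale1r. Qed.

Lemma push_bdry X Y (f : continuousType X Y) j (c : chain X j.+1) :
  bdry (push f c) = push f (bdry c).
Proof.
elim/chain_ind : c => [|x y IHx IHy|s]; first by rewrite !raddf0.
  by rewrite !raddfB /= IHx IHy.
rewrite pushU !bdryU raddf_sum; apply: eq_bigr => i _.
rewrite [LHS]freegU_sign [in RHS]freegU_sign raddfMz /= pushU; congr (<< _ >> *~ _).
exact/continuousEP.
Qed.

Lemma pushK X Y (f : continuousType X Y) (g : continuousType Y X) j :
  cancel f g -> cancel (@push X Y f j) (@push Y X g j).
Proof.
move=> fK; elim/chain_ind => [|x y IHx IHy|s]; first by rewrite !raddf0.
  by rewrite !raddfB /= IHx IHy.
by rewrite !pushU; congr << _ >>; apply/continuousEP => x /=; rewrite fK.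
Qed.

End SingularChains.

Section Homology.
Local Open Scope quotient_scope.
Variable R : realType.
Implicit Types X Y : topologicalType.

Local Notation chain X j := (Defs.chain R X j).
Local Notation cycle X j := (Defs.cycle R X j).
Local Notation cycles X j := (Defs.cycles R X j).
Local Notation boundaries X j := (Defs.boundaries R X j).
Local Notation rhomology X j := (Defs.rhomology R X j).

Lemma rhomology_pi_eq0 X j (z : cycle X j) :
  (\pi_(Quotient.quot (boundaries X j)) z = 0) <-> exists b, \val z = bdry b.
Proof.
rewrite -[X in _ = X]pi_zeror.
split => [/eqP|zb]; last apply/eqP.
  by rewrite -Quotient.idealrBE subr0 => /asboolP.
by rewrite -Quotient.idealrBE subr0; exact/asboolP.
Qed.

Lemma acyclicP X : acyclic R X <->
  forall j (c : chain X j), c \in cycles X j -> exists b, c = bdry b.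
Proof.
split => [acX j c cZ|bX j].
  exact/(rhomology_pi_eq0 (Sub c cZ : cycle X j))/acX.
by elim/quotW => z; apply/rhomology_pi_eq0/bX/(valP z).
Qed.

(** The class sent to 1 by the isomorphism with Z would vanish. This is what puts every base face
    into the boundary. *)
Lemma acyclic_sphereF X k : acyclic R X -> ~ sphere_homology R X k.
Proof.
move=> acX [[f [g fK gK]] _].
by have := gK 1; rewrite (acX _ (g 1)) raddf0.
Qed.

(** The empty simplex maps to any space, so it gives a nonzero cycle in [chain 0]; if [X] has no
    points, then [chain 1] is zero and nothing bounds that cycle. *)
Lemma acyclic_neq0 X : acyclic R X -> inhabited X.
Proof.
move=> /acyclicP acX; apply: contrapT => X0.
have noS (s : continuousType (stdsimplex R 1) X) : False.
  have x1 : stdsimplex R 1 (const_mx 1).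
    by split=> [i|]; rewrite ?big_ord1 mxE.
  by apply: X0; exists; exact: s (SigSub (mem_set x1)).
have e0 (x : stdsimplex R 0) : False.
  have [_ /eqP] := set_mem (valP x).
  by rewrite big_ord0 eq_sym oner_eq0.
pose s0 (x : stdsimplex R 0) : X := match e0 x with end.
have cs0 : continuous s0 by move=> x; have := e0 x.
pose HS := isContinuous.Build _ _ s0 cs0.
pose s : continuousType (stdsimplex R 0) X := HB.pack s0 HS.
have [//|b] := acX 0%N << s >>.
have -> : b = 0.
  by elim/chain_ind : b => [//|x y -> ->|t]; [rewrite subr0 | have := noS t].
by rewrite raddf0 => /eqP; rewrite freegU_eq0 oner_eq0.
Qed.

Section Push.
Variables (X Y : topologicalType) (f : continuousType X Y).

Lemma push_cycles j (c : chain X j) : c \in cycles X j -> push f c \in cycles Y j.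
Proof.
case: j c => [//|j] c; rewrite !unfold_in => /eqP c0.
by rewrite push_bdry c0 raddf0.
Qed.

Definition cpush j (z : cycle X j) : cycle Y j :=
  Sub (push f (\val z)) (push_cycles (valP z)).

Definition hpush j (h : rhomology X j) : rhomology Y j :=
  \pi_(Quotient.quot (boundaries Y j)) (cpush (repr h)).

(** Independence of the representative chosen by [repr]: two of them differ by a boundary, which
    [push] carries to a boundary. *)
Lemma hpush_pi j (z : cycle X j) :
  hpush (\pi_(Quotient.quot (boundaries X j)) z) =
  \pi_(Quotient.quot (boundaries Y j)) (cpush z).
Proof.
apply/eqP; rewrite -Quotient.idealrBE.
pose Q := Quotient.quot (boundaries X j).
have : \pi_Q (repr (\pi_Q z)) == \pi_Q z by rewrite reprK.
rewrite -Quotient.idealrBE => /asboolP[b zb]; apply/asboolP; exists (push f b).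
by rewrite push_bdry -zb !raddfB.
Qed.

Lemma hpush_additive j : additive (@hpush j).
Proof.
move=> x y; elim/quotW : x => x; elim/quotW : y => y.
rewrite -raddfB /= !hpush_pi -raddfB /=.
by congr (\pi _); apply: val_inj; rewrite /= !raddfB.
Qed.

HB.instance Definition _ j :=
  GRing.isAdditive.Build (rhomology X j) (rhomology Y j) (@hpush j)
    (@hpush_additive j).

End Push.

Lemma hpushK X Y (f : continuousType X Y) (g : continuousType Y X) j :
  cancel f g -> cancel (@hpush X Y f j) (@hpush Y X g j).
Proof.
move=> fK h; elim/quotW : h => z; rewrite (hpush_pi f) (hpush_pi g).
by rewrite (_ : cpush g (cpush f z) = z) //; apply: val_inj; rewrite /= pushK.
Qed.

(** Every class of the retract [Y] is the image of its own push to [X], where it vanishes. *)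
Lemma homeo_acyclic X Y (f : continuousType X Y) (g : continuousType Y X) :
  cancel g f -> acyclic R X -> acyclic R Y.
Proof. by move=> gK acX j h; rewrite -(hpushK gK h) (acX _ (hpush g h)) raddf0. Qed.

Lemma homeo_sphere_homology X Y (f : continuousType X Y)
    (g : continuousType Y X) k :
  cancel f g -> cancel g f -> sphere_homology R X k -> sphere_homology R Y k.
Proof.
move=> fK gK [[u [v uK vK]] X0]; split => [|j h jk].
  exists (u \o @hpush Y X g k); exists (@hpush X Y f k \o v) => x /=.
    by rewrite uK hpushK.
  by rewrite hpushK.
by rewrite -(hpushK gK h) (X0 _ (hpush g h)) ?raddf0.
Qed.

End Homology.

Lemma cvg_mx (R : realType) (T : Type) (F : set_system T) (FF : Filter F) m n
    (f : T -> 'M[R]_(m, n)) (A : 'M[R]_(m, n)) :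
  (forall i j, f x i j @[x --> F] --> A i j) -> f @ F --> A.
Proof.
move=> fA U [P AP PU]; rewrite /= !nbhs_simpl /=.
have : F (fun x => forall i j, P i j (f x i j)).
  by apply: filter_forall => i; apply: filter_forall => j; exact: fA (AP i j).
by apply: filterS => x Px; exact: PU.
Qed.

(** * Coning singular simplices towards a point *)

Section ConeConstruction.
Variables (R : realType) (n : nat) (X D : set 'rV[R]_n) (N : 'rV[R]_n -> 'rV[R]_n).
Variables (p : 'rV[R]_n) (K : R).
Hypothesis N_id : forall x, X x -> N x = x.
Hypothesis N_cont : forall y, D y -> {for y, continuous N}.
Hypothesis N_in : forall y, D y -> X (N y).
Hypothesis Dp : D p.
Hypothesis D_seg : forall x s, X x -> 0 <= s <= 1 -> D (s *: p + (1 - s) *: x).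
Hypothesis X_bounded : forall x, X x -> `|x| <= K.

Local Notation simplex j := (continuousType (stdsimplex R j) X).

Definition tail_row j (t : 'rV[R]_j.+1) : 'rV[R]_j := \row_k t 0 (lift ord0 k).

(** A total version of [s], so that the cone formula can be written on row vectors without a
    membership proof. *)
Definition extend0 j (s : simplex j) (y : 'rV[R]_j) : 'rV[R]_n :=
  if insub y is Some y' then val (s (y' : stdsimplex R j)) else 0.

(* At [t 0 0 = 1] the argument of [extend0 s] is junk, but its coefficient
   vanishes. *)
Definition cone_line j (s : simplex j) (t : 'rV[R]_j.+1) : 'rV[R]_n :=
  t 0 0 *: p +
  (1 - t 0 0) *: extend0 s ((1 - t 0 0)^-1 *: tail_row t).

Lemma extend0_val j (s : simplex j) (y : stdsimplex R j) :
  extend0 s (val y) = val (s y).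
Proof. by rewrite /extend0 valK. Qed.

Lemma stdsimplex_head j (t : 'rV[R]_j.+1) : stdsimplex R j.+1 t ->
  0 <= t 0 0 <= 1.
Proof.
move=> [t0 t1]; rewrite t0 /= -t1 big_ord_recl.
by rewrite lerDl; apply: sumr_ge0 => i _; exact: t0.
Qed.

Lemma stdsimplex_tail j (t : 'rV[R]_j.+1) : stdsimplex R j.+1 t -> t 0 0 != 1 ->
  stdsimplex R j ((1 - t 0 0)^-1 *: tail_row t).
Proof.
move=> tS; have /andP[t00 t01] := stdsimplex_head tS; move: tS => [t0 t1] tn1.
have d0 : 0 < 1 - t 0 0 by rewrite subr_gt0 lt_neqAle tn1.
split=> [i|]; first by rewrite !mxE mulr_ge0 ?invr_ge0 ?(ltW d0).
rewrite (eq_bigr (fun i => (1 - t 0 0)^-1 * t 0 (lift ord0 i))); last first.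
  by move=> i _; rewrite !mxE.
have e : \sum_(i < j) t 0 (lift ord0 i) = 1 - t 0 0.
  by apply/eqP; rewrite eq_sym subr_eq -t1 big_ord_recl addrC.
by rewrite -mulr_sumr e mulVf // gt_eqF.
Qed.

Lemma cone_line_in j (s : simplex j) (t : 'rV[R]_j.+1) : stdsimplex R j.+1 t ->
  D (cone_line s t).
Proof.
move=> tS; rewrite /cone_line; have [->|tn1] := eqVneq (t 0 0) 1.
  by rewrite scale1r subrr scale0r addr0.
have yS := stdsimplex_tail tS tn1.
rewrite -[_ *: tail_row t]/(val (SigSub (mem_set yS) : stdsimplex R j)).
rewrite extend0_val; apply: D_seg; last exact: stdsimplex_head.
exact: set_mem (valP _).
Qed.

Lemma extend0_bounded j (s : simplex j) y : `|extend0 s y| <= Num.max 0 K.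
Proof.
rewrite /extend0; case: insub => [y'|]; last by rewrite normr0 le_max lexx.
by rewrite le_max X_bounded ?orbT //; exact: set_mem (valP _).
Qed.

Lemma cone_line_cvg j (s : simplex j) (F : set_system (stdsimplex R j.+1))
    (t0 : stdsimplex R j.+1) : Filter F ->
  val t @[t --> F] --> val t0 ->
  cone_line s (val t) @[t --> F] --> cone_line s (val t0).
Proof.
move=> FF cv.
have c0 i : (val t : 'rV_ _) 0 i @[t --> F] --> (val t0 : 'rV_ _) 0 i.
  exact: (cvg_comp _ _ cv (@coord_continuous _ _ _ 0 i _)).
(* At the cone vertex the rescaled tail has in general no limit; the second term still tends to 0,
   being a bounded vector (by [K]) times a coefficient that tends to 0. *)
have [t1|tn1] := eqVneq ((val t0 : 'rV_ _) 0 0) 1.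
- have -> : cone_line s (val t0) = p.
    by rewrite /cone_line t1 scale1r subrr scale0r addr0.
  have h1 : (val t : 'rV_ _) 0 0 *: p @[t --> F] --> p.
    by rewrite -[X in _ --> X]scale1r -t1; apply: cvgZr_tmp; exact: c0.
  rewrite /cone_line -[X in _ --> X](addr0 p); apply: cvgD; first exact: h1.
  apply/cvgr0Pnorm_le => e e0.
  (* The summand 1 keeps the divisor positive when the bound is 0. *)
  have C0 : 0 < Num.max 0 K + 1 by rewrite ltr_wpDl // le_max lexx.
  have c1 : 1 - (val t : 'rV_ _) 0 0 @[t --> F] --> 1 - (val t0 : 'rV_ _) 0 0.
    by apply: cvgB; [exact: cvg_cst|exact: c0].
  rewrite t1 subrr in c1.
  move/cvgr0Pnorm_le : c1 => /(_ (e / (Num.max 0 K + 1))).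
  rewrite divr_gt0 // => /(_ isT); apply: filterS => t te.
  rewrite normrZ (le_trans (ler_pM _ _ te (extend0_bounded _ _))) //.
  by rewrite -mulrA ler_piMr ?ltW // mulrC ltr_pdivrMr // mul1r ltrDl.
- apply: cvgD; first by apply: cvgZr_tmp; exact: c0.
  apply: cvgZ; first by apply: cvgB; [exact: cvg_cst|exact: c0].
  have tS := set_mem (valP t0).
  have yS := stdsimplex_tail tS tn1.
  set y0 : stdsimplex R j := SigSub (mem_set yS).
  have cs : (val (s y) @[y --> y0] : set_system _) --> val (s y0).
    apply: (@continuous_comp _ _ _ s val); first exact: (@cts_fun _ _ s).
    exact: initial_continuous.
  (* The simplex carries the initial topology, so a neighbourhood of [y0] is the trace of an open
     set [W] of row vectors, and convergence of the rescaled tail in the ambient space suffices. *)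
  move=> U; rewrite -[_ *: tail_row _]/(val y0) extend0_val => /cs.
  case=> _ /= [] [W oW <-] /= Wy0 WU.
  have cq : (1 - (val t : 'rV_ _) 0 0)^-1 *: tail_row (val t) @[t --> F] -->
      val y0.
    apply: cvgZ; first last.
      apply: cvg_mx => i k; rewrite mxE.
      rewrite (_ : (fun t => _) = (fun t : stdsimplex R j.+1 =>
        (val t : 'rV_ _) 0 (lift ord0 k))); first exact: c0.
      by apply/funext => t; rewrite mxE.
    apply: cvgV; first by rewrite subr_eq0 eq_sym.
    by apply: cvgB; [exact: cvg_cst|exact: c0].
  have nW : nbhs (val y0) W by exact: open_nbhs_nbhs.
  have nt : \forall t \near F, (val t : 'rV_ _) 0 0 != 1.
    have : nbhs ((val t0 : 'rV_ _) 0 0) [set r : R | r != 1].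
      by apply: open_nbhs_nbhs; split => //; exact: open_neq.
    exact: c0.
  rewrite /= nbhs_simpl; apply: filterS2 nt (cq _ nW) => t tn /= Wt.
  have tS' := stdsimplex_tail (set_mem (valP t)) tn.
  rewrite -[_ *: tail_row _]/(val (SigSub (mem_set tS') : stdsimplex R j)).
  rewrite extend0_val.
  exact: WU.
Qed.

Lemma cone_line_continuous j (s : simplex j) :
  continuous (fun t : stdsimplex R j.+1 => cone_line s (val t)).
Proof.
move=> t0.
exact: (@cone_line_cvg _ s (nbhs t0) t0 _ (@initial_continuous _ _ set_val t0)).
Qed.

Definition cone_fun j (s : simplex j) (t : stdsimplex R j.+1) : X :=
  SigSub (mem_set (N_in (cone_line_in s (set_mem (valP t))))).

Lemma cone_fun_continuous j (s : simplex j) : continuous (cone_fun s).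
Proof.
apply: continuous_comp_initial => t.
apply: (@continuous_comp _ _ _
  (fun t : stdsimplex R j.+1 => cone_line s (val t)) N).
  exact: cone_line_continuous.
by apply: N_cont; exact: cone_line_in (set_mem (valP t)).
Qed.

HB.instance Definition _ j (s : simplex j) :=
  isContinuous.Build _ _ (cone_fun s) (@cone_fun_continuous j s).

Lemma cone_face0 j (s : simplex j) :
  (cone_fun s \o face_map ord0 : simplex j) = s.
Proof.
apply/continuousEP => y; apply: val_inj => /=; rewrite /cone_line.
have -> : insert0 ord0 (val y) 0 0 = 0 by rewrite mxE unlift_none.
rewrite scale0r add0r subr0 invr1 !scale1r.
have -> : tail_row (insert0 ord0 (val y)) = val y.
  by apply/rowP => k; rewrite !mxE liftK.
by rewrite extend0_val N_id //; exact: set_mem (valP _).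
Qed.

Lemma cone_faceS j (s : simplex j.+1) (i : 'I_j.+1) :
  (cone_fun s \o face_map (lift ord0 i) : simplex j.+1) =
  cone_fun (s \o face_map i : simplex j).
Proof.
apply/continuousEP => y; apply: val_inj => /=; congr N; rewrite /cone_line.
set t := val y.
have -> : insert0 (lift ord0 i) t 0 0 = t 0 0.
  rewrite mxE; case: unliftP => [k /(congr1 val)|/(congr1 val)] //= e.
  by congr (t 0 _); apply: val_inj; move: e; rewrite /= /bump; lia.
(* At the cone vertex both junk terms have coefficient 0; elsewhere the rescaled tail is a genuine
   point of the simplex. *)
have [->|tn1] := eqVneq (t 0 0) 1; first by rewrite subrr !scale0r.
congr (_ + _ *: _).
have yS := stdsimplex_tail (set_mem (valP y)) tn1.
have -> : (1 - t 0 0)^-1 *: tail_row (insert0 (lift ord0 i) t) =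
    val (face_map i (SigSub (mem_set yS))).
  apply/rowP => k /=; rewrite !mxE; case: (unliftP i k) => [k' ->|->].
    rewrite !mxE; congr (_ * _).
    case: unliftP => [l /(congr1 val)|/(congr1 val)] /=.
      move=> e; congr (t 0 _); apply: val_inj => /=; move: e.
      by rewrite /bump /=; lia.
    by rewrite /bump /=; lia.
  by rewrite unlift_none mulr0.
rewrite -[_ *: tail_row t]/(val (SigSub (mem_set yS) : stdsimplex R j)).
by rewrite !extend0_val.
Qed.

(** Face 0 of a cone is the simplex itself and the other faces are cones on its faces, so
    [bdry (k c) = c - k (bdry c)] and a cycle [c] is the boundary of [k c]. *)
Lemma star_acyclic : acyclic R X.
Proof.
apply/acyclicP => j c cZ.
pose k j : chain R X j -> chain R X j.+1 := fglift (fun s : simplex j =>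
  << (cone_fun s : simplex j.+1) >> : chain R X j.+1).
have kB i (x y : chain R X i) : k i (x - y) = k i x - k i y.
  exact: lift_is_additive.
have k0 i : k i 0 = 0 by rewrite -[0 in LHS](subrr 0) kB subrr.
have kU i s : k i << s >> = << (cone_fun s : simplex i.+1) >>.
  by rewrite /k liftU scale1r.
pose HA i := GRing.isAdditive.Build _ _ (k i) (@kB i).
exists (k j c); case: j c cZ => [c _|j c /eqP c0].
  (* In the bottom degree every chain is a cycle: the cone on the empty simplex is the point [N p],
     whose only face is the empty simplex. *)
  elim/chain_ind : c => [|x y IHx IHy|s]; first by rewrite k0 raddf0.
    by rewrite kB raddfB /= -IHx -IHy.
  by rewrite kU bdryU big_ord1 expr0 cone_face0.
suff : bdry (k j.+1 c) = c - k j (bdry c) by rewrite c0 k0 subr0.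
move: {c0} c; elim/chain_ind => [|x y IHx IHy|s].
  by rewrite !(raddf0, k0) addr0.
  by rewrite kB !raddfB /= kB IHx IHy !opprD !opprK addrACA.
rewrite kU [LHS]bdryU big_ord_recl expr0 cone_face0; congr (_ + _).
rewrite bdryU.
pose k' : {additive chain R X j -> chain R X j.+1} := HB.pack (k j) (HA j).
rewrite -[k j]/(k' : _ -> _) raddf_sum -sumrN; apply: eq_bigr => i _.
rewrite freegU_sign cone_faceS lift0 exprS mulN1r mulrNz; congr (- _).
by rewrite [X in k' X]freegU_sign raddfMz /= kU.
Qed.

End ConeConstruction.

(** * Subsets of Euclidean space *)

Section SetHomeo.
Variables (R : realType) (n m : nat) (X : set 'rV[R]_n) (Y : set 'rV[R]_m).

Lemma restrict_continuous (f : 'rV[R]_n -> 'rV[R]_m) :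
  (forall x, X x -> Y (f x)) -> (forall x, X x -> {for x, continuous f}) ->
  exists F : continuousType X Y, forall x, val (F x) = f (val x).
Proof.
move=> fY fc.
pose F (x : X) : Y := SigSub (mem_set (fY _ (set_mem (valP x)))).
have Fc : continuous F.
  apply: continuous_comp_initial => x.
  apply: (@continuous_comp _ _ _ set_val f); first exact: initial_continuous.
  exact/fc/set_mem/(valP x).
pose HF := isContinuous.Build _ _ F Fc.
pose F0 : continuousType X Y := HB.pack F HF.
by exists F0.
Qed.

End SetHomeo.

(** Continuity of the ambient maps at the points of the sets is stronger than continuity on the
    subspaces; explicit formulas involving [normalize] provide it directly. *)
Definition set_homeo (R : realType) n m (X : set 'rV[R]_n) (Y : set 'rV[R]_m)
    (f : 'rV[R]_n -> 'rV[R]_m) (g : 'rV[R]_m -> 'rV[R]_n) :=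
  [/\ forall x, X x -> [/\ Y (f x), g (f x) = x & {for x, continuous f}] &
      forall y, Y y -> [/\ X (g y), f (g y) = y & {for y, continuous g}]].

Lemma set_homeo_continuous (R : realType) n m (X : set 'rV[R]_n)
    (Y : set 'rV[R]_m) f g :
  set_homeo X Y f g ->
  exists (F : continuousType X Y) (G : continuousType Y X),
    cancel F G /\ cancel G F.
Proof.
move=> [Xf Yg].
have [|//|F FE] := @restrict_continuous R n m X Y f; try by move=> x /Xf[].
have [|//|G GE] := @restrict_continuous R m n Y X g; try by move=> x /Yg[].
exists F, G; split=> x; apply: val_inj; rewrite !(FE, GE).
  by have [] := Xf _ (set_mem (valP x)).
by have [] := Yg _ (set_mem (valP x)).
Qed.

Lemma set_homeo_acyclic (R : realType) n m (X : set 'rV[R]_n)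
    (Y : set 'rV[R]_m) f g :
  set_homeo X Y f g -> acyclic R X -> acyclic R Y.
Proof. by move=> /set_homeo_continuous[F [G [_ GK]]]; exact: homeo_acyclic GK. Qed.

Lemma set_homeo_sphere (R : realType) n m (X : set 'rV[R]_n)
    (Y : set 'rV[R]_m) f g k :
  set_homeo X Y f g -> sphere_homology R X k -> sphere_homology R Y k.
Proof.
by move=> /set_homeo_continuous[F [G [FK GK]]]; exact: homeo_sphere_homology FK GK.
Qed.

(** * The dot product and radial projection to the unit sphere *)

Section Dot.
Variables (R : realType) (n : nat).
Implicit Types u v w : 'rV[R]_n.

Lemma dotpE u v : dotp u v = (u *m v^T) 0 0.
Proof. by rewrite mxE; apply: eq_bigr => i _; rewrite mxE. Qed.

Lemma dotpC u v : dotp u v = dotp v u.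
Proof. by apply: eq_bigr => i _; rewrite mulrC. Qed.

Lemma dotpDl u v w : dotp (u + v) w = dotp u w + dotp v w.
Proof. by rewrite !dotpE mulmxDl mxE. Qed.

Lemma dotpZl a u w : dotp (a *: u) w = a * dotp u w.
Proof. by rewrite !dotpE -scalemxAl mxE. Qed.

Lemma dotpNl u w : dotp (- u) w = - dotp u w.
Proof. by rewrite -scaleN1r dotpZl mulN1r. Qed.

Lemma dotpDr u v w : dotp w (u + v) = dotp w u + dotp w v.
Proof. by rewrite dotpC dotpDl !(dotpC w). Qed.

Lemma dotpZr a u w : dotp w (a *: u) = a * dotp w u.
Proof. by rewrite dotpC dotpZl (dotpC w). Qed.

Lemma dotpNr u w : dotp w (- u) = - dotp w u.
Proof. by rewrite dotpC dotpNl (dotpC w). Qed.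

Lemma dotp0l w : dotp 0 w = 0.
Proof. by rewrite -[0](scale0r 0) dotpZl mul0r. Qed.

Lemma dotp_ge0 v : 0 <= dotp v v.
Proof. by apply: sumr_ge0 => i _; rewrite -expr2 sqr_ge0. Qed.

Lemma dotp_eq0 v : (dotp v v == 0) = (v == 0).
Proof.
apply/eqP/eqP => [v0|->]; last exact: dotp0l.
apply/rowP => i; rewrite mxE; apply/eqP; rewrite -sqrf_eq0 expr2.
have sq_ge0 j : true -> 0 <= v 0 j * v 0 j by rewrite -expr2 sqr_ge0.
by move/eqP: v0; rewrite psumr_eq0 // => /allP/(_ i (mem_index_enum i)).
Qed.

Lemma dotp_gt0 v : v != 0 -> 0 < dotp v v.
Proof. by move=> v0; rewrite lt_neqAle dotp_ge0 eq_sym dotp_eq0 v0. Qed.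

Lemma cvg_dotp (T : Type) (F : set_system T) (FF : Filter F)
    (f g : T -> 'rV[R]_n) u v :
  f @ F --> u -> g @ F --> v -> dotp (f x) (g x) @[x --> F] --> dotp u v.
Proof.
move=> fu gv; rewrite /dotp; elim: (index_enum _) => [|i r IHr].
  by under eq_fun do rewrite big_nil; rewrite big_nil; exact: cvg_cst.
under eq_fun do rewrite big_cons; rewrite big_cons; apply: cvgD => //.
by apply: cvgM; [exact: (cvg_comp _ _ fu (@coord_continuous _ _ _ 0 i _))|
  exact: (cvg_comp _ _ gv (@coord_continuous _ _ _ 0 i _))].
Qed.

Definition normalize v := (Num.sqrt (dotp v v))^-1 *: v.

Lemma normalize_coef v : v != 0 -> 0 < (Num.sqrt (dotp v v))^-1.
Proof. by move=> v0; rewrite invr_gt0 sqrtr_gt0 dotp_gt0. Qed.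

Lemma dotp_normalize v : v != 0 -> dotp (normalize v) (normalize v) = 1.
Proof.
move=> v0; rewrite dotpZl dotpZr mulrA -expr2 exprVn sqr_sqrtr ?dotp_ge0 //.
by rewrite mulVf // dotp_eq0.
Qed.

Lemma unit_neq0 v : dotp v v = 1 -> v != 0.
Proof. by move=> v1; rewrite -dotp_eq0 v1 oner_eq0. Qed.

Lemma normalizeZ c v : 0 < c -> dotp v v = 1 -> normalize (c *: v) = v.
Proof.
move=> c0 v1; rewrite /normalize dotpZl dotpZr v1 mulr1 -expr2 sqrtr_sqr.
by rewrite gtr0_norm // scalerA mulVf ?scale1r // gt_eqF.
Qed.

Lemma normalize_unit v : dotp v v = 1 -> normalize v = v.
Proof. by move=> v1; rewrite -[v in LHS]scale1r normalizeZ. Qed.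

Lemma cvg_normalize (T : Type) (F : set_system T) (FF : Filter F)
    (f : T -> 'rV[R]_n) u :
  u != 0 -> f @ F --> u -> normalize (f x) @[x --> F] --> normalize u.
Proof.
move=> u0 fu; apply: cvgZ => //; apply: cvgV.
  by rewrite gt_eqF // sqrtr_gt0 dotp_gt0.
apply: (@continuous_cvg _ R R F FF _ (@Num.sqrt R)); first exact: sqrt_continuous.
exact: cvg_dotp.
Qed.

End Dot.

(** * Loops in a star-shaped set *)

Section StarPi1.
Variables (R : realType) (n : nat).
Implicit Types (A B : set 'rV[R]_n).

Definition clamp (x : R) : R := Num.max 0 (Num.min 1 x).

Lemma clamp_ge0 x : 0 <= clamp x.
Proof. by rewrite le_max lexx. Qed.

Lemma clamp_le1 x : clamp x <= 1.
Proof. by rewrite ge_max ler01 ge_min lexx. Qed.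

Lemma clamp_id x : 0 <= x <= 1 -> clamp x = x.
Proof. by move=> /andP[x0 x1]; rewrite /clamp min_r // max_r. Qed.

Lemma clamp0 x : x <= 0 -> clamp x = 0.
Proof. by move=> x0; rewrite /clamp max_l // ge_min x0 orbT. Qed.

Lemma clamp1 x : 1 <= x -> clamp x = 1.
Proof. by move=> x1; rewrite /clamp min_l // max_r. Qed.

Lemma cvg_minr (T : Type) (F : set_system T) (FF : Filter F) (f g : T -> R) a b :
  f @ F --> a -> g @ F --> b -> Num.min (f x) (g x) @[x --> F] --> Num.min a b.
Proof.
move=> fa gb; rewrite minr_absE; under eq_fun do rewrite minr_absE.
apply: cvgM; last exact: cvg_cst.
by apply: cvgB; [exact: cvgD|apply: cvg_norm; exact: cvgB].
Qed.

Lemma cvg_clamp (T : Type) (F : set_system T) (FF : Filter F) (f : T -> R) a :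
  f @ F --> a -> clamp (f x) @[x --> F] --> clamp a.
Proof.
have clampE x : clamp x = - Num.min 0 (- Num.min 1 x).
  by rewrite oppr_min oppr0 opprK.
move=> fa; rewrite clampE; under eq_fun do rewrite clampE.
apply: cvgN; apply: cvg_minr; first exact: cvg_cst.
by apply: cvgN; apply: cvg_minr => //; exact: cvg_cst.
Qed.

(** A loop is continuous only within the unit interval; precomposing with [clamp] makes it
    continuous on all of [R], so that the homotopy can be treated as a map on the whole plane. *)
Lemma clamp_continuous_comp (g : R -> 'rV[R]_n) :
  {within `[0, 1]%classic, continuous g} -> continuous (g \o clamp).
Proof.
move=> /subspace_continuousP gc x.
apply: (@cvg_comp _ _ _ clamp g (nbhs x)
  (within `[0, 1]%classic (nbhs (clamp x)))).
  move=> U; rewrite /within /= => nU.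
  have := @cvg_clamp _ (nbhs x) (nbhs_filter x) id x cvg_id _ nU.
  rewrite /= !nbhs_simpl /=; apply: filterS => y; apply.
  by rewrite /= in_itv /= clamp_ge0 clamp_le1.
by apply: gc; rewrite /= in_itv /= clamp_ge0 clamp_le1.
Qed.

(* With [rho = min 1 (3t) (3 - 3t)], the loop [g] is first slowed down to the
   middle third of the parameter interval, its interior is then pushed to the
   apex [p] along the segments of the star (the outer thirds following the
   segment from [a] to [p] and back), and that tree-like path is retracted. *)
Lemma star_pi1_surjective A B p : A `<=` B ->
  (forall x s, B x -> 0 <= s <= 1 -> B (s *: p + (1 - s) *: x)) ->
  pi1_surjective R A B.
Proof.
move=> AB Bp a Aa g [gc gB g0 g1]; exists (fun=> a).
  by split=> //; apply: continuous_subspaceT => x; exact: cst_continuous.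
pose rho (t : R) := Num.min (clamp (3 * t)) (clamp (3 - 3 * t)).
(* The homotopy is the loop [g] at [s = 1]. As [s] decreases, [clamp (3 - 3 * s)],
   [clamp (2 - 3 * s)] and [clamp (1 - 3 * s)] grow from 0 to 1 one after the other, each over a
   third of the interval, and drive the three stages. *)
pose x (s t : R) := t + clamp (3 - 3 * s) * (2 * t - 1).
pose w1 (s t : R) := 1 - clamp (2 - 3 * s) * rho t.
pose w2 (s t : R) := clamp (1 - 3 * s) * rho t.
pose H (st : R * R) := p + w1 st.1 st.2 *: (g (clamp (x st.1 st.2)) - p)
  + w2 st.1 st.2 *: (a - p).
have rho01 t : 0 <= rho t <= 1.
  by rewrite le_min !clamp_ge0 /= ge_min clamp_le1.
have rho0 : rho 0 = 0.
  by rewrite /rho (clamp0 (x := 3 * 0)) ?mulr0 // min_l // clamp_ge0.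
have rho1 : rho 1 = 0.
  by rewrite /rho mulr1 subrr [X in Num.min _ X]clamp0 // min_r // clamp_ge0.
(* [B] is star-shaped but perhaps not convex, so [H] must stay on a segment from [p] to a single
   point of [B]: either [w2] vanishes (which [1 <= 3 * s] ensures), or [w1] does, or both weights
   belong to the same point [a]. *)
have key s t : 0 <= t <= 1 ->
    [\/ 1 <= 3 * s, w1 s t = 0 | g (clamp (x s t)) = a].
  move=> /andP[t0 t1].
  have [s3|s3] := leP 1 (3 * s); first exact: Or31.
  have c1 : clamp (2 - 3 * s) = 1 by rewrite clamp1 //; lra.
  have c2 : clamp (3 - 3 * s) = 1 by rewrite clamp1 //; lra.
  have [t3|t3] := leP (3 * t) 1.
    by apply: Or33; rewrite /x c2 clamp0 //; lra.
  have [t4|t4] := leP 2 (3 * t).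
    by apply: Or33; rewrite /x c2 clamp1 //; lra.
  apply: Or32; rewrite /w1 c1 /rho !clamp1 ?minxx ?mulr1 ?subrr //; lra.
have w01 s t : [/\ 0 <= w1 s t, w1 s t <= 1, 0 <= w2 s t & w1 s t + w2 s t <= 1].
  have /andP[r0 r1] := rho01 t.
  have := clamp_ge0 (2 - 3 * s); have := clamp_le1 (2 - 3 * s).
  have := clamp_ge0 (1 - 3 * s).
  have : clamp (1 - 3 * s) <= clamp (2 - 3 * s).
    by apply: le_max2 => //; apply: le_min2 => //; lra.
  rewrite /w1 /w2; move: (clamp _) (clamp _) => c c' *; split; nra.
exists H; split.
- apply: continuous_subspaceT => st; rewrite /H.
  have cf : (fst : R * R -> R) @ st --> st.1 by exact: cvg_fst.
  have cs : (snd : R * R -> R) @ st --> st.2 by exact: cvg_snd.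
  have cM (c : R) (f : R * R -> R) (r : R) :
      f @ st --> r -> (c * f y) @[y --> st] --> c * r.
    by move=> fc; apply: cvgM => //; exact: cvg_cst.
  have cB (c c' : R) (f : R * R -> R) (r : R) : f @ st --> r ->
      clamp (c - c' * f y) @[y --> st] --> clamp (c - c' * r).
    by move=> fc; apply: cvg_clamp; apply: cvgB; [exact: cvg_cst|exact: cM].
  have crho : rho y.2 @[y --> st] --> rho st.2.
    by rewrite /rho; apply: cvg_minr; [apply: cvg_clamp; exact: cM|exact: cB].
  apply: cvgD; first apply: cvgD; first exact: cvg_cst.
  + apply: cvgZ.
      by apply: cvgB; [exact: cvg_cst|apply: cvgM => //; exact: cB].
    apply: cvgB; last exact: cvg_cst.
    apply: (@continuous_cvg _ R 'rV[R]_n _ _ (fun y => x y.1 y.2) (g \o clamp)).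
      exact: clamp_continuous_comp.
    apply: cvgD => //; apply: cvgM; first exact: cB.
    by apply: cvgB; [exact: cM|exact: cvg_cst].
  + by apply: cvgZ; [apply: cvgM => //; exact: cB|exact: cvg_cst].
- move=> [s t] [_ /=]; rewrite in_itv /= => t01.
  rewrite /H /=; have [w10 w11 w20 w12] := w01 s t.
  have Ba : B a by exact: AB.
  have comb c y : B y -> 0 <= c <= 1 -> B (p + c *: (y - p)).
    move=> By c01; have := Bp y (1 - c) By; rewrite subKr.
    have -> : (1 - c) *: p + c *: y = p + c *: (y - p).
      by rewrite scalerBl scale1r scalerBr addrAC addrA.
    by apply; lra.
  have Bg : B (g (clamp (x s t))).
    by apply: gB; rewrite /= in_itv /= clamp_ge0 clamp_le1.
  have [s3|->|->] := key s t t01.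
  + have -> : w2 s t = 0 by rewrite /w2 clamp0 ?mul0r //; lra.
    by rewrite scale0r addr0; apply: comb => //; rewrite w10.
  + by rewrite scale0r addr0; apply: comb => //; lra.
  + by rewrite -addrA -scalerDl; apply: comb => //; lra.
- move=> t; rewrite /= in_itv /= => t01; rewrite /H /=; split.
  + have e1 : w1 0 t = 1 - rho t by rewrite /w1 mulr0 subr0 clamp1 ?mul1r //; lra.
    have e2 : w2 0 t = rho t by rewrite /w2 mulr0 subr0 clamp1 ?mul1r.
    have [s3|w10|->] := key 0 t t01.
    * by move: s3; rewrite mulr0 ler10.
    * have r1 : rho t = 1 by apply/eqP; rewrite eq_sym -subr_eq0 -e1 w10.
      by rewrite w10 scale0r addr0 e2 r1 scale1r addrC subrK.
    * by rewrite e1 e2 -addrA -scalerDl subrK scale1r addrC subrK.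
  + have e1 : w1 1 t = 1 by rewrite /w1 clamp0 ?mul0r ?subr0 //; lra.
    have e2 : w2 1 t = 0 by rewrite /w2 clamp0 ?mul0r //; lra.
    have e3 : clamp (3 - 3 * 1) = 0 by rewrite clamp0 // mulr1 subrr.
    rewrite e1 e2 /x e3 mul0r addr0 clamp_id // scale1r scale0r addr0.
    by rewrite addrC subrK.
- move=> s _; rewrite /H /= /w1 /w2 /x rho0 rho1 !mulr0 !subr0.
  rewrite !scale1r !scale0r !addr0.
  have c := clamp_ge0 (3 - 3 * s).
  rewrite clamp0 ?g0; last by rewrite add0r sub0r mulrN1 oppr_le0.
  rewrite clamp1 ?g1; first by rewrite addrC subrK.
  by rewrite mulr1 [2]mulrSr addrK mulr1 lerDl.
Qed.

End StarPi1.

(** * Polytopes and pyramids *)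

Section Convexity.
Variables (R : realType) (n : nat).
Implicit Types (F G P : set 'rV[R]_n) (x y v : 'rV[R]_n).

Definition is_convex G := forall x y s, G x -> G y -> 0 <= s <= 1 ->
  G (s *: x + (1 - s) *: y).

(** Weights indexed by [nat] are not tied to the size of the list and survive mapping and
    consing. *)
Lemma conv_hullP (s : seq 'rV[R]_n) x : conv_hull s x <->
  exists w : nat -> R, [/\ forall i, 0 <= w i, \sum_(i < size s) w i = 1 &
    x = \sum_(i < size s) w i *: s`_i].
Proof.
split=> [[w [w0 w1 ->]]|[w [w0 w1 ->]]]; last by exists (fun i => w i).
exists (fun i => if insub i is Some j then w j else 0); split=> [i||].
- by case: insubP.
- by rewrite -w1; apply: eq_bigr => i _; rewrite valK.
- by apply: eq_bigr => i _; rewrite valK.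
Qed.

Lemma polytope_convex P : polytope P -> is_convex P.
Proof.
move=> [s ->] x y t /conv_hullP[u [u0 u1 ->]] /conv_hullP[v [v0 v1 ->]].
move=> /andP[t0 t1].
apply/conv_hullP; exists (fun i => t * u i + (1 - t) * v i); split=> [i||].
- by rewrite addr_ge0 // mulr_ge0 // subr_ge0.
- by rewrite big_split /= -!mulr_sumr u1 v1 !mulr1 addrC subrK.
- rewrite !scaler_sumr -big_split /=; apply: eq_bigr => i _.
  by rewrite !scalerA -scalerDl.
Qed.

Lemma polytope_bounded P : polytope P -> exists K, forall x, P x -> `|x| <= K.
Proof.
move=> [s ->]; exists (\sum_(i < size s) `|s`_i|) => x /conv_hullP[w [w0 w1 ->]].
apply: (le_trans (ler_norm_sum _ _ _)); apply: ler_sum => i _.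
rewrite normrZ ger0_norm // ler_piMl // -w1 (bigD1 i) //= lerDl.
exact: sumr_ge0.
Qed.

(* The cone over [{1} * G], with apex [0]. *)
Definition homog G (s : R) v := (s = 0 /\ v = 0) \/ (0 < s /\ G (s^-1 *: v)).

(** The vector [(u + v) / (s + t)] is the convex combination of [u / s] and [v / t] with weight
    [s / (s + t)]. Sums of many weighted points then need no renormalization. *)
Lemma homogD G s t u v : is_convex G -> homog G s u -> homog G t v ->
  homog G (s + t) (u + v).
Proof.
move=> cG [[-> ->]|[s0 Gu]]; first by rewrite !add0r.
move=> [[-> ->]|[t0 Gv]]; first by rewrite !addr0; right.
have st0 : 0 < s + t by rewrite addr_gt0.
right; split=> //.
have := cG _ _ (s / (s + t)) Gu Gv.
have -> : 1 - s / (s + t) = t / (s + t) by field; rewrite gt_eqF.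
rewrite !scalerA [s / _ * _]mulrAC divff ?gt_eqF // mul1r.
rewrite [t / _ * _]mulrAC divff ?gt_eqF // mul1r -scalerDr; apply.
by apply/andP; split; [rewrite divr_ge0 ?ltW|
  rewrite ler_pdivrMr // mul1r lerDl ltW].
Qed.

Lemma homogZ G s v : G v -> 0 <= s -> homog G s (s *: v).
Proof.
move=> Gv; rewrite le_eqVlt => /orP[/eqP<-|s0]; first by left; rewrite scale0r.
by right; rewrite scalerA mulVf ?gt_eqF // scale1r.
Qed.

Lemma homog1 G v : homog G 1 v -> G v.
Proof. by move=> [[/eqP]|[_]]; rewrite ?oner_eq0 // invr1 scale1r. Qed.

Lemma affinely_free_dim P k : affinely_free P k -> (k <= dim P)%N.
Proof.
move=> Pk; have kn : (k < n.+1)%N.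
  by have [x [A [_ _ /eqP <-]]] := Pk; rewrite ltnS rank_leq_col.
by rewrite /dim (bigD1 (Ordinal kn)) ?leq_maxl //=; exact/asboolP.
Qed.

Lemma dim_le P k (A : 'M[R]_(k, n)) x0 :
  (forall x, P x -> (x - x0 <= A)%MS) -> (dim P <= k)%N.
Proof.
move=> PA; apply/bigmax_leqP => j /asboolP[x [B [Px PB /eqP <-]]].
apply: leq_trans (rank_leq_row A); apply: mxrankS; apply/row_subP => i.
have -> : row i B = (x + row i B - x0) - (x - x0).
  by rewrite opprB addrA subrK addrAC subrr add0r.
by apply: addmx_sub; [exact: PA|rewrite eqmx_opp; exact: PA].
Qed.

Lemma dim_eq P k x (A : 'M[R]_(k, n)) : P x -> row_free A ->
  (forall i, P (x + row i A)) -> (forall y, P y -> (y - x <= A)%MS) -> dim P = k.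
Proof.
move=> Px fA PA PsubA; apply/eqP; rewrite eqn_leq (dim_le PsubA) /=.
by apply: affinely_free_dim; exists x, A.
Qed.

Lemma affinely_free_extend P k x (A : 'M[R]_(k, n)) y : P x -> row_free A ->
  (forall i, P (x + row i A)) -> P y -> ~ (y - x <= A)%MS ->
  affinely_free P (k + 1).
Proof.
move=> Px fA PA Py yA; exists x, (col_mx A (y - x)); split=> // [i|].
  rewrite -[i]splitK; case: (fintype.split i) => j /=; first by rewrite rowKu.
  by rewrite rowKd row_id addrC subrK.
rewrite -row_leq_rank -addsmxE; move: yA fA; rewrite -row_leq_rank => yA fA.
have : (A < A + (y - x))%MS.
  rewrite /ltmx addsmxSl /=; apply/negP => AyA; apply: yA.
  exact: submx_trans (addsmxSr _ _) AyA.
by move=> /rank_ltmx; rewrite addn1; exact: leq_ltn_trans.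
Qed.

(** A family of maximal size spans: a point of [P] outside its affine hull would extend it beyond
    [dim P]. *)
Lemma dim_basis P : P !=set0 -> exists x (A : 'M[R]_(dim P, n)),
  [/\ P x, row_free A, forall i, P (x + row i A) &
      forall y, P y -> (y - x <= A)%MS].
Proof.
move=> [x0 Px0]; have : affinely_free P (dim P).
  rewrite /dim; elim/big_ind : _ => [|i j Pi Pj|k /asboolP//].
    by exists x0, 0; split=> //; [case|rewrite /row_free mxrank0].
  by rewrite /maxn; case: ifP.
move=> [x [A [Px PA fA]]]; exists x, A; split=> // y Py; apply: contrapT => yA.
have := affinely_free_dim (affinely_free_extend Px fA PA Py yA).
by rewrite addn1 ltnn.
Qed.

(* [x0] is the barycentre of a maximal affinely independent family in [F]. *)
Lemma relint F : is_convex F -> F !=set0 -> exists x0 (A : 'M[R]_(dim F, n)),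
  [/\ F x0, row_free A, forall y, F y -> (y - x0 <= A)%MS &
      forall c : 'rV_(dim F), exists2 e, 0 < e & F (x0 + e *: (c *m A))].
Proof.
move=> cF /dim_basis[x [A [Fx fA FA AF]]]; set k := dim F in A fA FA AF *.
pose q : R := k.+1%:R^-1.
have q0 : 0 < q by rewrite invr_gt0 ltr0n.
have kq : k%:R * q + q = 1.
  by rewrite -[X in _ + X]mul1r -mulrDl -mulrSr mulfV ?pnatr_eq0.
have comb (c : 'rV_k) : (forall i, 0 <= q + c 0 i) -> \sum_i c 0 i <= q ->
    F (x + (const_mx q + c) *m A).
  move=> c0 c1; apply: homog1.
  have -> : x + (const_mx q + c) *m A =
      (1 - \sum_i (q + c 0 i)) *: x + \sum_i (q + c 0 i) *: (x + row i A).
    rewrite mulmx_sum_row [X in _ = _ + X](eq_bigr (fun i =>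
      (q + c 0 i) *: x + (q + c 0 i) *: row i A)); last first.
      by move=> i _; rewrite scalerDr.
    rewrite [X in _ = _ + X]big_split /= -scaler_suml addrA -scalerDl subrK scale1r.
    by congr (_ + _); apply: eq_bigr => i _; rewrite !mxE.
  have s1 : 0 <= 1 - \sum_i (q + c 0 i).
    rewrite subr_ge0 big_split /= sumr_const card_ord -mulr_natl.
    by rewrite -[leRHS]kq lerD2l.
  have /(homogD cF (homogZ Fx s1)) : homog F (\sum_i (q + c 0 i))
      (\sum_i (q + c 0 i) *: (x + row i A)).
    elim/big_ind2 : _ => [|*|i _]; [by left|exact: homogD|exact: homogZ].
  by rewrite subrK.
exists (x + const_mx q *m A), A; split=> //.
- by rewrite -[const_mx q]addr0; apply: comb => [i|]; [rewrite mxE addr0 ltW|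
    rewrite big1 ?ltW // => i _; rewrite mxE].
- move=> y Fy; rewrite opprD addrA; apply: addmx_sub; first exact: AF.
  by rewrite eqmx_opp submxMl.
(* The barycentric weights are all [q] at [x0]. This step changes each of them, and also their sum
   over the rows, by at most [q], so all weights, that of [x] included, stay nonnegative. *)
move=> c; pose e := q / (1 + \sum_i `|c 0 i|).
have S0 : 0 < 1 + \sum_i `|c 0 i| by rewrite ltr_pwDl // sumr_ge0.
have e0 : 0 < e by rewrite divr_gt0.
have eS : e * (1 + \sum_i `|c 0 i|) = q by rewrite divfK // gt_eqF.
exists e => //; rewrite -addrA scalemxAl -mulmxDl; apply: comb => [i|].
  rewrite mxE -eS mulrDr mulr1.
  have : `|c 0 i| <= \sum_i `|c 0 i| by rewrite (bigD1 i) //= lerDl sumr_ge0.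
  have := ler_norm (- c 0 i); rewrite normrN; nra.
under eq_bigr do rewrite mxE.
rewrite -mulr_sumr -eS ler_pM2l // -[X in X <= _]add0r lerD // ler_sum // => i _.
exact: ler_norm.
Qed.

End Convexity.

(** * Base and pyramid cells, and the cone complex *)

Section Pt.
Variables (R : realType) (n : nat).
Implicit Types (x y : 'rV[R]_n) (h k : R) (F G : set 'rV[R]_n).

Definition pt x h : 'rV[R]_(n + 1) := row_mx x h%:M.
Definition hor (v : 'rV[R]_(n + 1)) : 'rV[R]_n := lsubmx v.
Definition ver (v : 'rV[R]_(n + 1)) : R := rsubmx v 0 0.

Lemma hor_pt x h : hor (pt x h) = x. Proof. exact: row_mxKl. Qed.
Lemma ver_pt x h : ver (pt x h) = h.
Proof. by rewrite /ver /pt row_mxKr mxE ?eqxx ?mulr1n. Qed.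

Lemma ptK v : pt (hor v) (ver v) = v.
Proof. by rewrite /pt -mx11_scalar hsubmxK. Qed.

Lemma pt_inj x y h k : pt x h = pt y k -> x = y /\ h = k.
Proof.
by move=> e; move: (congr1 hor e) (congr1 ver e); rewrite !hor_pt !ver_pt.
Qed.

Lemma ptD x y h k : pt x h + pt y k = pt (x + y) (h + k).
Proof. by rewrite /pt add_row_mx -raddfD. Qed.

Lemma ptZ a x h : a *: pt x h = pt (a *: x) (a * h).
Proof. by rewrite /pt scale_row_mx scale_scalar_mx. Qed.

Lemma ptN x h : - pt x h = pt (- x) (- h).
Proof. by rewrite -scaleN1r ptZ scaleN1r mulN1r. Qed.

Lemma ptB x y h k : pt x h - pt y k = pt (x - y) (h - k).
Proof. by rewrite ptN ptD. Qed.

Lemma pt0 x : row_mx x 0 = pt x 0.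
Proof. by rewrite /pt raddf0. Qed.

Lemma dotp_pt x y h k : dotp (pt x h) (pt y k) = dotp x y + h * k.
Proof.
rewrite !dotpE /pt tr_row_mx mul_row_col mxE; congr (_ + _).
by rewrite tr_scalar_mx -scalar_mxM mxE.
Qed.

Lemma cvg_pt (T : Type) (D : set_system T) (FD : Filter D)
    (f : T -> 'rV[R]_n) (g : T -> R) x h :
  f @ D --> x -> g @ D --> h -> pt (f t) (g t) @[t --> D] --> pt x h.
Proof.
move=> fx gh; apply: cvg_mx => i j; rewrite !ord1 -[j]splitK.
case: (fintype.split j) => k /=.
  rewrite row_mxEl; under eq_fun do rewrite row_mxEl.
  exact: (cvg_comp _ _ fx (@coord_continuous _ _ _ 0 k _)).
rewrite row_mxEr; under eq_fun do rewrite row_mxEr.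
by rewrite !ord1 mxE; under eq_fun do rewrite mxE.
Qed.

Lemma cvg_hor (T : Type) (D : set_system T) (FD : Filter D)
    (f : T -> 'rV[R]_(n + 1)) v :
  f @ D --> v -> hor (f t) @[t --> D] --> hor v.
Proof.
move=> fv; apply: cvg_mx => i j; rewrite mxE; under eq_fun do rewrite mxE.
exact: (cvg_comp _ _ fv (@coord_continuous _ _ _ i _ _)).
Qed.

Lemma cvg_ver (T : Type) (D : set_system T) (FD : Filter D)
    (f : T -> 'rV[R]_(n + 1)) v :
  f @ D --> v -> ver (f t) @[t --> D] --> ver v.
Proof.
move=> fv; rewrite /ver mxE; under eq_fun do rewrite mxE.
exact: (cvg_comp _ _ fv (@coord_continuous _ _ _ 0 _ _)).
Qed.

Definition base F : set 'rV[R]_(n + 1) :=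
  (fun x : 'rV[R]_n => row_mx x (0 : 'rV[R]_1)) @` F.

Definition apex : 'rV[R]_(n + 1) := pt 0 1.

(* The separate case makes [pyramid set0] the vertex [{apex}]. *)
Definition pyramid F : set 'rV[R]_(n + 1) := [set v | v = apex \/
  exists x s, [/\ F x, 0 <= s <= 1 & v = pt ((1 - s) *: x) s]].

Lemma baseP F v : base F v <-> exists2 x, F x & v = pt x 0.
Proof.
split=> [[x Fx <-]|[x Fx ->]]; first by exists x => //; rewrite pt0.
by exists x => //; rewrite pt0.
Qed.

Lemma base_pt F x h : base F (pt x h) <-> F x /\ h = 0.
Proof.
split=> [/baseP[y Fy /pt_inj[-> ->]]//|[Fx ->]].
by apply/baseP; exists x.
Qed.

Lemma pyramid_apex F : pyramid F apex. Proof. by left. Qed.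

Lemma base_pyramid F : base F `<=` pyramid F.
Proof.
move=> _ /baseP[x Fx ->]; right; exists x, 0.
split=> //; first by rewrite lexx ler01.
by rewrite subr0 scale1r.
Qed.

Lemma pyramid_sub F G : F `<=` G -> pyramid F `<=` pyramid G.
Proof. by move=> FG v [->|[x [s [/FG Gx s01 ->]]]]; [left|right; exists x, s]. Qed.

Lemma pyramid0 F x : pyramid F (pt x 0) <-> F x.
Proof.
split=> [[/pt_inj[_ /eqP]|[y [s [Fy _ /pt_inj[-> <-]]]]]|Fx].
- by rewrite eq_sym oner_eq0.
- by rewrite subr0 scale1r.
- by apply/base_pyramid/base_pt.
Qed.

Lemma pyramid_sub_inv F G : pyramid F `<=` pyramid G -> F `<=` G.
Proof. by move=> FG x Fx; apply/pyramid0/FG/pyramid0. Qed.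

Lemma base_sub F G : base F `<=` base G <-> F `<=` G.
Proof.
split=> FG; last by move=> _ [x /FG Gx <-]; exists x.
by move=> x Fx; have /FG/base_pt[] : base F (pt x 0) by exact/base_pt.
Qed.

Lemma base_sub_pyramid F G : base F `<=` pyramid G <-> F `<=` G.
Proof.
split=> FG; last exact: subset_trans (iffRL (base_sub _ _) FG) (@base_pyramid G).
by move=> x Fx; apply/pyramid0/FG/base_pt.
Qed.

Lemma pyramid_base F G : ~ pyramid F `<=` base G.
Proof. by move=> /(_ _ (pyramid_apex F))/base_pt[_ /eqP]; rewrite oner_eq0. Qed.

Lemma pyramid_star F v s : pyramid F v -> 0 <= s <= 1 ->
  pyramid F (s *: apex + (1 - s) *: v).
Proof.
move=> [->|[x [t [Fx t01 ->]]]] s01.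
  by left; rewrite -scalerDl addrC subrK scale1r.
right; exists x, (s + (1 - s) * t); split=> //; first by nra.
rewrite !ptZ ptD scaler0 add0r scalerA mulr1; congr pt; congr (_ *: _); ring.
Qed.

Lemma sum_pt (s : seq 'rV[R]_n) (w : nat -> R) :
  \sum_(i < size s) w i *: (map (pt^~ 0) s)`_i =
  pt (\sum_(i < size s) w i *: s`_i) 0.
Proof.
suff sum_r r : (r <= size s)%N -> \sum_(i < r) w i *: (map (pt^~ 0) s)`_i =
    pt (\sum_(i < r) w i *: s`_i) 0 by exact: sum_r.
elim: r => [_|r IHr rs]; first by rewrite !big_ord0 /pt raddf0 row_mx0.
rewrite !big_ord_recr /= IHr ?(ltnW rs) // (nth_map 0) // ptZ ptD.
by rewrite mulr0 addr0.
Qed.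

Lemma base_polytope F : polytope F -> polytope (base F).
Proof.
move=> [s ->]; exists (map (pt^~ 0) s).
apply/seteqP; split=> [v /baseP[x /conv_hullP[w [w0 w1 ->]] ->]|v].
  by apply/conv_hullP; exists w; rewrite size_map sum_pt.
move=> /conv_hullP[w []]; rewrite size_map => w0 w1 ->.
by rewrite sum_pt; apply/base_pt; split=> //; apply/conv_hullP; exists w.
Qed.

Lemma pyramid_polytope F : polytope F -> polytope (pyramid F).
Proof.
move=> [s ->]; exists (apex :: map (pt^~ 0) s).
have hullE v : conv_hull (apex :: map (pt^~ 0) s) v <->
  exists (a : R) (w : nat -> R),
    [/\ 0 <= a, forall i, 0 <= w i, a + \sum_(i < size s) w i = 1 &
     v = pt (\sum_(i < size s) w i *: s`_i) a].
  have recl (V : zmodType) (f : nat -> V) :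
      \sum_(i < (size s).+1) f i = f 0%N + \sum_(i < size s) f i.+1.
    exact: big_ord_recl.
  have sumE (w : nat -> R) :
      \sum_(i < (size s).+1) w i *: (apex :: map (pt^~ 0) s)`_i =
      pt (\sum_(i < size s) w i.+1 *: s`_i) (w 0%N).
    rewrite (recl _ (fun i => w i *: (apex :: map (pt^~ 0) s)`_i)) /=.
    by rewrite (sum_pt _ (fun i => w i.+1)) ptZ ptD mulr1 addr0 scaler0 add0r.
  split=> [/conv_hullP[w []]|[a [w [a0 w0 aw ->]]]].
    rewrite /= size_map sumE (recl _ w) => w0 w1 ->.
    by exists (w 0%N), (w \o S); split=> //=.
  pose w' i := if i is j.+1 then w j else a.
  apply/conv_hullP; exists w'; rewrite /= size_map (sumE w') (recl _ w').
  by split; [case|exact: aw|].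
apply/seteqP; split=> v.
  move=> pv; apply/hullE.
  case: pv => [->|[x [t [/conv_hullP[w [w0 w1 ->]] t01 ->]]]].
    exists 1, (fun=> 0); rewrite big1 // addr0 big1 // => i _; exact: scale0r.
  exists t, (fun i => (1 - t) * w i); split; first by case/andP: t01.
  - by move=> i; rewrite mulr_ge0 // subr_ge0; case/andP: t01.
  - by rewrite -mulr_sumr w1 mulr1 addrC subrK.
  - by rewrite scaler_sumr; congr pt; apply: eq_bigr => i _; rewrite scalerA.
move=> /hullE[a [w [a0 w0 aw ->]]].
have [a1|a1] := eqVneq a 1.
  left; rewrite a1 big1 // => i _.
  suff -> : w i = 0 by rewrite scale0r.
  have /eqP := aw; rewrite a1 -[eqbRHS]addr0 (inj_eq (addrI _)).
  by rewrite psumr_eq0 // => /allP/(_ i (mem_index_enum i))/eqP.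
have d0 : 0 < 1 - a.
  rewrite subr_gt0 lt_neqAle a1 /= -aw lerDl; exact: sumr_ge0.
right; exists (\sum_(i < size s) ((1 - a)^-1 * w i) *: s`_i), a; split.
- apply/conv_hullP; exists (fun i => (1 - a)^-1 * w i); split=> // [i|].
    by rewrite mulr_ge0 // invr_ge0 ltW.
  rewrite -mulr_sumr (_ : \sum_(i < _) w i = 1 - a) ?mulVf ?gt_eqF //.
  by rewrite -aw addrC addKr.
- by rewrite a0 /= ltW // -subr_gt0.
- rewrite scaler_sumr; congr pt; apply: eq_bigr => i _.
  by rewrite scalerA mulrA divff ?mul1r // gt_eqF.
Qed.

Lemma base_face F G : is_face F G -> is_face (base F) (base G).
Proof.
move=> [c [b [Gb ->]]]; exists (pt c 0), b; split=> [_ /baseP[x Gx ->]|].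
  by rewrite dotp_pt mulr0 addr0; exact: Gb.
apply/seteqP; split=> [_ /baseP[x [Gx cx] ->]|_ [/baseP[x Gx ->]]] /=.
  by split; [exact/base_pt|rewrite dotp_pt mulr0 addr0].
by rewrite dotp_pt mulr0 addr0 => cx; apply/base_pt.
Qed.

(** The last coefficient [b - 1] gives the apex a value strictly below [b], which cuts it off. *)
Lemma base_face_pyramid F G : is_face F G -> is_face (base F) (pyramid G).
Proof.
move=> [c [b [Gb ->]]]; exists (pt c (b - 1)), b; split.
  move=> _ [->|[x [s [Gx /andP[s0 s1] ->]]]]; rewrite dotp_pt.
    by rewrite dotpC dotp0l; lra.
  by rewrite dotpZr; have := Gb _ Gx; nra.
apply/seteqP; split=> [_ /baseP[x [Gx cx] ->]|v [Gv]] /=.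
  by split; [exact/pyramid0|rewrite dotp_pt mulr0 addr0].
case: Gv => [->|[x [s [Gx /andP[s0 s1] ->]]]]; rewrite dotp_pt.
  by rewrite dotpC dotp0l => e; exfalso; lra.
rewrite dotpZr => e; have cx := Gb _ Gx.
have s00 : s = 0 by nra.
rewrite s00 subr0 scale1r in e *; apply/base_pt; split=> //; split=> //=; lra.
Qed.

(** The last coefficient [b] puts the apex on the supporting hyperplane. *)
Lemma pyramid_face F G : is_face F G -> is_face (pyramid F) (pyramid G).
Proof.
move=> [c [b [Gb ->]]]; exists (pt c b), b; split.
  move=> _ [->|[x [s [Gx /andP[s0 s1] ->]]]]; rewrite dotp_pt.
    by rewrite dotpC dotp0l; lra.
  by rewrite dotpZr; have := Gb _ Gx; nra.
apply/seteqP; split=> v.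
  move=> [->|[x [s [[Gx /= cx] s01 ->]]]] /=; rewrite dotp_pt.
    by split; [left|rewrite dotpC dotp0l; lra].
  by split; [right; exists x, s|rewrite dotpZr cx; ring].
move=> [[->|[x [s [Gx s01 ->]]]] /=]; rewrite dotp_pt; first by left.
rewrite dotpZr => e; have [->|s1] := eqVneq s 1.
  by left; rewrite subrr scale0r.
right; exists x, s; split=> //; split=> //=.
have /mulfI : 1 - s != 0 by rewrite subr_eq0 eq_sym.
by apply; lra.
Qed.

Lemma face_base H F : is_face H (base F) -> exists2 G, is_face G F & H = base G.
Proof.
move=> [c [b [Fb ->]]]; rewrite -[c]ptK in Fb *.
exists (F `&` [set x | dotp (hor c) x = b]).
  exists (hor c), b; split=> // x Fx.
  have /Fb : base F (pt x 0) by exact/base_pt.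
  by rewrite dotp_pt mulr0 addr0.
apply/seteqP; split=> [_ [/baseP[x Fx ->]]|_ /baseP[x [Fx /= cx] ->]] /=.
  by rewrite dotp_pt mulr0 addr0 => cx; exact/base_pt.
by split; [exact/base_pt|rewrite dotp_pt mulr0 addr0].
Qed.

(** The functional takes the value [k] at the apex, and [k = b] or [k < b] decides between the two
    shapes. If the apex alone attains [b], the face of [F] is empty and [H] is [pyramid set0]. *)
Lemma face_pyramid H F : is_face H (pyramid F) ->
  exists2 G, is_face G F & H = base G \/ H = pyramid G.
Proof.
move=> [c [b [Fb ->]]]; rewrite -[c]ptK in Fb *.
move: (hor c) (ver c) Fb => {}c k Fb.
have cb x : F x -> dotp c x <= b.
  by move=> /pyramid0/Fb; rewrite dotp_pt mulr0 addr0.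
have kb : k <= b.
  by have := Fb _ (pyramid_apex F); rewrite dotp_pt dotpC dotp0l; lra.
exists (F `&` [set x | dotp c x = b]); first by exists c, b.
have [kb1|kb1] := eqVneq k b; [right|left]; apply/seteqP; split.
- move=> _ [[->|[x [s [Fx s01 ->]]]] /=]; rewrite dotp_pt; first by left.
  rewrite dotpZr => e; have [->|s1] := eqVneq s 1.
    by left; rewrite subrr scale0r.
  right; exists x, s; split=> //; split=> //=.
  have /mulfI : 1 - s != 0 by rewrite subr_eq0 eq_sym.
  by apply; move: e; rewrite kb1; lra.
- move=> _ [->|[x [s [[Fx /= cx] s01 ->]]]] /=; rewrite dotp_pt.
    by split; [left|rewrite dotpC dotp0l; lra].
  by split; [right; exists x, s|rewrite dotpZr cx kb1; ring].
- have {kb1}kb1 : k < b by rewrite lt_neqAle kb1.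
  move=> _ [[->|[x [s [Fx /andP[s0 s1] ->]]]] /=]; rewrite dotp_pt.
    by rewrite dotpC dotp0l => e; exfalso; lra.
  rewrite dotpZr => e; have cx := cb _ Fx.
  have s00 : s = 0 by nra.
  rewrite s00 subr0 scale1r in e *; apply/base_pt; split=> //; split=> //=; lra.
- move=> _ /baseP[x [Fx /= cx] ->]; split; first exact/pyramid0.
  by rewrite /= dotp_pt mulr0 addr0.
Qed.

Lemma baseI F G : base F `&` base G = base (F `&` G).
Proof.
apply/seteqP; split=> [_ [/baseP[x Fx ->] /base_pt[Gx _]]|_ /baseP[x [Fx Gx] ->]].
  exact/base_pt.
by split; exact/base_pt.
Qed.

Lemma base_pyramidI F G : base F `&` pyramid G = base (F `&` G).
Proof.
apply/seteqP; split=> [_ [/baseP[x Fx ->] /pyramid0 Gx]|_ /baseP[x [Fx Gx] ->]].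
  exact/base_pt.
by split; [exact/base_pt|exact/pyramid0].
Qed.

Lemma pyramidI F G : pyramid F `&` pyramid G = pyramid (F `&` G).
Proof.
apply/seteqP; split=> v.
  move=> [[->|[x [s [Fx s01 ->]]]]]; first by left.
  move=> [->|[y [t [Gy t01 /pt_inj[xy ts]]]]]; first by left.
  have [s1|s1] := eqVneq s 1; first by left; rewrite s1 subrr scale0r.
  right; exists x, s; split=> //; split=> //.
  suff -> : x = y by [].
  rewrite -ts in xy; apply: (scalerI _ xy).
  by rewrite subr_eq0 eq_sym.
move=> [->|[x [s [[Fx Gx] s01 ->]]]]; first by split; left.
by split; right; exists x, s.
Qed.

Section ConeComplex.
Variable M : polycomplex R n.

(** The empty cell of [M] contributes both the empty cell and, as [pyramid set0], the apex. *)
Definition cone_cells : set (set 'rV[R]_(n + 1)) :=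
  (base @` cells M) `|` (pyramid @` cells M).

Lemma cone_cells_finite : finite_set cone_cells.
Proof.
by rewrite finite_setU; split; apply: finite_image; exact: cells_finite.
Qed.

Lemma cone_cells_polytope P : cone_cells P -> polytope P.
Proof.
by move=> [[F /cells_polytope MF <-]|[F /cells_polytope MF <-]];
  [exact: base_polytope|exact: pyramid_polytope].
Qed.

Lemma cone_cells_empty : cone_cells set0.
Proof. by left; exists set0; [exact: cells_empty|exact: image_set0]. Qed.

Lemma cone_cells_face (E P : set 'rV[R]_(n + 1)) :
  cone_cells P -> is_face E P -> cone_cells E.
Proof.
move=> [[G MG <-] /face_base[H HG ->]|[G MG <-] /face_pyramid[H HG [->|->]]].
- by left; exists H => //; exact: cells_face HG.
- by left; exists H => //; exact: cells_face HG.
- by right; exists H => //; exact: cells_face HG.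
Qed.

Lemma cone_cells_meet P Q : cone_cells P -> cone_cells Q ->
  is_face (P `&` Q) P /\ is_face (P `&` Q) Q.
Proof.
move=> [] [F MF <-] [] [G MG <-]; have [f1 f2] := cells_meet MF MG.
- by rewrite baseI; split; exact: base_face.
- by rewrite base_pyramidI; split; [exact: base_face|exact: base_face_pyramid].
- rewrite setIC base_pyramidI setIC.
  by split; [exact: base_face_pyramid|exact: base_face].
- by rewrite pyramidI; split; exact: pyramid_face.
Qed.

Definition cone_complex : polycomplex R (n + 1) :=
  PolyComplex cone_cells_finite cone_cells_polytope cone_cells_empty
    cone_cells_face cone_cells_meet.

End ConeComplex.

End Pt.

(** * Dimensions of base and pyramid cells *)

Section Dimensions.
Variables (R : realType) (n : nat).
Implicit Types (F G : set 'rV[R]_n).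

Lemma dim_set0 : dim (set0 : set 'rV[R]_n) = 0%N.
Proof.
by apply/eqP; rewrite -leqn0; apply: (@dim_le _ _ _ _ (0 : 'M[R]_(0, n)) 0).
Qed.

Lemma pt_sub k (A : 'M[R]_(k, n)) x : (x <= A)%MS ->
  (pt x 0 <= row_mx A (0 : 'M[R]_(k, 1)))%MS.
Proof.
move=> /submxP[c ->]; rewrite /pt raddf0.
by apply/submxP; exists c; rewrite mul_mx_row mulmx0.
Qed.

Lemma dim_base F : F !=set0 -> dim (base F) = dim F.
Proof.
move=> /dim_basis[x [A [Fx fA FA AF]]].
apply: (@dim_eq _ _ _ _ (pt x 0) (row_mx A 0)).
- exact/base_pt.
- have /row_freeP[B AB] := fA; apply/row_freeP; exists (col_mx B 0).
  by rewrite mul_row_col AB mul0mx addr0.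
- by move=> i; rewrite row_row_mx row0 pt0 ptD addr0; exact/base_pt.
- by move=> _ /baseP[y Fy ->]; rewrite ptB subrr; exact/pt_sub/AF.
Qed.

Lemma dim_pyramid F : F !=set0 -> dim (pyramid F) = (dim F + 1)%N.
Proof.
move=> /dim_basis[x [A [Fx fA FA AF]]].
pose A' := col_mx (row_mx A 0) (pt (- x) 1).
have A'1 : (row_mx A 0 <= A')%MS by rewrite -addsmxE addsmxSl.
have A'2 : (pt (- x) 1 <= A')%MS by rewrite -addsmxE addsmxSr.
apply: (@dim_eq _ _ _ _ (pt x 0) A').
- by apply/base_pyramid/base_pt.
(* The last row is the vector from [x] to the apex, so the matrix is block triangular with diagonal
   blocks [A] and 1, and its right inverse is explicit. *)
- have /row_freeP[B AB] := fA; apply/row_freeP; exists (block_mx B 0 (x *m B) 1%:M).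
  rewrite /A' -[col_mx _ _]/(block_mx A 0 (- x) 1%:M) mulmx_block.
  rewrite !mulmx0 !mul0mx !mulmx1 !mul1mx AB mulNmx !addr0 addNr add0r.
  by rewrite -scalar_mx_block.
- move=> i; rewrite -[i]splitK; case: (fintype.split i) => j /=.
    by rewrite rowKu row_row_mx row0 pt0 ptD addr0; apply/base_pyramid/base_pt.
  by rewrite rowKd row_id ptD subrr add0r; left.
- move=> _ [->|[y [s [Fy s01 ->]]]]; first by rewrite ptB sub0r subr0.
  have -> : pt ((1 - s) *: y) s - pt x 0 =
      s *: pt (- x) 1 + (1 - s) *: pt (y - x) 0.
    rewrite !ptZ ptB ptD mulr1 mulr0 addr0 subr0; congr pt.
    by rewrite scalerBr scalerN addrCA -opprD -scalerDl [s + _]addrC subrK scale1r.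
  apply: addmx_sub; apply: scalemx_sub => //.
  by apply: submx_trans A'1; exact/pt_sub/AF.
Qed.

(** As [dim set0] is 0 by convention, the formula [dim F + 1] fails for the apex, which is therefore
    treated apart. *)
Lemma dim_pyramid0 : dim (pyramid (set0 : set 'rV[R]_n)) = 0%N.
Proof.
apply/eqP; rewrite -leqn0.
apply: (@dim_le _ _ _ _ (0 : 'M[R]_(0, n + 1)) (apex R n)).
by move=> x [->|[y [s []]]//]; rewrite subrr sub0mx.
Qed.

End Dimensions.

(** * Tangent directions and orthogonality *)

Section Tangent.
Variables (R : realType) (n : nat).
Implicit Types (F G : set 'rV[R]_n) (u v w x y z : 'rV[R]_n).

(** The pointing condition of [link], separated from the unit and orthogonality conditions because
    it is closed under sums and positive multiples for convex [F] and [G]. *)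
Definition tangent F G : set 'rV[R]_n :=
  [set v | exists x t, [/\ F x, 0 < t & G (x + t *: v)]].

Definition orth F v := forall x y, F x -> F y -> dotp v (x - y) = 0.

Lemma linkP (C : set (set 'rV[R]_n)) F v : link C F v <->
  [/\ dotp v v = 1, orth F v & exists G, [/\ C G, F `<=` G & tangent F G v]].
Proof. by []. Qed.

Lemma tangent_add F G u v : is_convex F -> is_convex G ->
  tangent F G u -> tangent F G v -> tangent F G (u + v).
Proof.
(* The weight [l] equalizes the two step lengths: [l * s = (1 - l) * t]. *)
move=> cF cG [x [s [Fx s0 Gu]]] [y [t [Fy t0 Gv]]].
pose l := t / (s + t); have st : 0 < s + t by rewrite addr_gt0.
have l01 : 0 <= l <= 1.
  by apply/andP; split; [rewrite divr_ge0 ?ltW|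
    rewrite ler_pdivrMr // mul1r lerDr ltW].
exists (l *: x + (1 - l) *: y), (s * t / (s + t)); split.
- exact: cF.
- by rewrite divr_gt0 ?mulr_gt0.
have := cG _ _ l Gu Gv l01.
rewrite !scalerDr !scalerA.
have -> : l * s = s * t / (s + t) by rewrite /l; ring.
have -> : (1 - l) * t = s * t / (s + t) by rewrite /l; field; rewrite gt_eqF.
by rewrite addrACA.
Qed.

Lemma tangent_scale F G c v : 0 < c -> tangent F G v -> tangent F G (c *: v).
Proof.
move=> c0 [x [t [Fx t0 Gv]]]; exists x, (t / c); split=> //; first exact: divr_gt0.
by rewrite scalerA divfK // gt_eqF.
Qed.

Lemma tangent_sub F G x y : F x -> G y -> tangent F G (y - x).
Proof. by move=> Fx Gy; exists x, 1; split=> //; rewrite scale1r addrC subrK. Qed.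

Lemma tangent_mono F G F' G' : F `<=` F' -> G `<=` G' ->
  tangent F G `<=` tangent F' G'.
Proof. by move=> FF GG v [x [t [/FF Fx t0 /GG Gv]]]; exists x, t. Qed.

Lemma tangent_scaleR F G h v : F `<=` G -> F !=set0 ->
  tangent F G v -> tangent F G (- v) -> tangent F G (h *: v).
Proof.
move=> FG [x Fx] tv tNv; have [h0|h0|->] := ltgtP h 0.
- rewrite -[h]opprK scaleNr -scalerN.
  by apply: tangent_scale => //; rewrite oppr_gt0.
- exact: tangent_scale.
- by exists x, 1; split=> //; rewrite scale0r scaler0 addr0; exact: FG.
Qed.

Lemma orth_scale F c v : orth F v -> orth F (c *: v).
Proof. by move=> ov x y Fx Fy; rewrite dotpZl ov ?mulr0. Qed.

Lemma orth_add F u v : orth F u -> orth F v -> orth F (u + v).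
Proof. by move=> ou ov x y Fx Fy; rewrite dotpDl ou ?ov ?addr0. Qed.

(** Normal equations: the Gram matrix [A *m A^T] is invertible, since a vector [v] in its kernel
    makes [v *m A] orthogonal to itself. *)
Lemma orth_proj k (A : 'M[R]_(k, n)) x : row_free A ->
  exists c : 'rV_k, forall d : 'rV_k, dotp (x - c *m A) (d *m A) = 0.
Proof.
move=> fA; have uG : A *m A^T \in unitmx.
  rewrite -row_free_unit; apply: inj_row_free => v vG.
  apply/eqP; rewrite -(mulmx_free_eq0 _ fA) -dotp_eq0 dotpE trmx_mul mulmxA.
  by rewrite -(mulmxA v) vG mul0mx mxE.
exists (x *m A^T *m invmx (A *m A^T)) => d.
by rewrite dotpE trmx_mul mulmxA mulmxBl -!mulmxA mulVmx // mulmx1 subrr mul0mx mxE.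
Qed.

(* [z] is the point of the affine hull of [F] closest to the origin. *)
Lemma foot F : is_convex F -> F !=set0 -> exists x0 z,
  [/\ F x0, tangent F F (x0 - z), tangent F F (z - x0), orth F z &
      forall v x, orth F v -> F x -> dotp v x = dotp v z].
Proof.
move=> cF /(relint cF)[x0 [A [Fx0 fA AF FA]]].
have [c cA] := orth_proj x0 fA.
(* Since [x0] is relatively interior, combinations of the rows of [A] of either sign point into [F];
   hence [x0 - z] and its opposite are both tangent. *)
have tA d : tangent F F (d *m A) by have [e e0 Fe] := FA d; exists x0, e.
have oA v d : orth F v -> dotp v (d *m A) = 0.
  move=> ov; have [e e0 Fe] := FA d; have := ov _ _ Fe Fx0.
  rewrite addrAC subrr add0r dotpZr => /eqP; rewrite mulf_eq0 (gt_eqF e0) /=.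
  by move/eqP.
exists x0, (x0 - c *m A); split=> //.
- by rewrite subKr.
- by rewrite addrAC subrr add0r -mulNmx.
- move=> x y /AF /submxP[d xd] /AF /submxP[d' yd].
  have -> : x - y = (d - d') *m A by rewrite mulmxBl -xd -yd opprB addrA subrK.
  exact: cA.
- move=> v x ov Fx; rewrite dotpDr dotpNr oA // subr0.
  by apply/eqP; rewrite -subr_eq0 -dotpNr -dotpDr ov.
Qed.

(** A link vector is orthogonal to [F], hence outside its direction space, and would give some cell
    containing [F] a dimension above [dim F]. *)
Lemma link_top F (C : set (set 'rV[R]_n)) : F !=set0 ->
  (forall G, C G -> (dim G <= dim F)%N) -> link C F = set0.
Proof.
move=> /dim_basis[x [A [Fx fA FA AF]]] CF; rewrite -subset0 => v.
move=> /linkP[v1 ov [G [/CF GF FG [x' [t [Fx' t0 Gv]]]]]].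
have : ~ ((x' + t *: v) - x <= A)%MS.
  move=> yA; have : (v <= A)%MS.
    have -> : v = t^-1 *: ((x' + t *: v - x) - (x' - x)).
      rewrite opprB addrA subrK addrAC subrr add0r.
      by rewrite scalerA mulVf ?scale1r ?gt_eqF.
    by apply: scalemx_sub; apply: addmx_sub => //; rewrite eqmx_opp; exact: AF.
  move=> /submxP[c vc].
  have : dotp v v = 0; last by rewrite v1 => /eqP; rewrite oner_eq0.
  rewrite {2}vc mulmx_sum_row; elim/big_ind : _ => [|a b va vb|i _].
  - by rewrite dotpC dotp0l.
  - by rewrite dotpDr va vb addr0.
  - have := ov _ _ (FA i) Fx; rewrite addrAC subrr add0r dotpZr => ->.
    by rewrite mulr0.
move=> /(affinely_free_extend (FG _ Fx) fA (fun i => FG _ (FA i)) Gv).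
by move=> /affinely_free_dim; rewrite addn1 leqNgt ltnS GF.
Qed.

(** The norm is the maximum norm; this supplies the bound [K = 1] when [star_acyclic] is applied to
    a link. *)
Lemma unit_norm_le1 v : dotp v v = 1 -> `|v| <= 1.
Proof.
move=> v1; rewrite [`|v|]mx_normrE; apply/bigmax_leP; split=> // -[i j] _ /=.
rewrite ord1 -(@ler_pXn2r _ 2) ?nnegrE // expr1n real_normK ?num_real // -v1.
rewrite /dotp (bigD1 j) //= -expr2 lerDl; apply: sumr_ge0 => k _.
by rewrite -expr2 sqr_ge0.
Qed.

End Tangent.

(** * Links in the cone *)

Section ConeLinks.
Variables (R : realType) (n : nat) (M : polycomplex R n).
Implicit Types (F G : set 'rV[R]_n).

Lemma cells_convex F : cells M F -> is_convex F.
Proof. by move=> /cells_polytope/polytope_convex. Qed.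

Lemma pyramid_convex F : cells M F -> is_convex (pyramid F).
Proof. by move=> /cells_polytope/pyramid_polytope/polytope_convex. Qed.

Lemma base_convex F : cells M F -> is_convex (base F).
Proof. by move=> /cells_polytope/base_polytope/polytope_convex. Qed.

Lemma tangent_base F G w : tangent F G w -> tangent (base F) (base G) (pt w 0).
Proof.
move=> [x [t [Fx t0 Gw]]]; exists (pt x 0), t; split=> //; first exact/base_pt.
by rewrite ptZ ptD mulr0 addr0; exact/base_pt.
Qed.

Lemma ver_pyramid_ge0 F v : pyramid F v -> 0 <= ver v.
Proof.
by move=> [->|[x [s [_ /andP[s0 _] ->]]]]; rewrite ver_pt.
Qed.

Lemma verD (u v : 'rV[R]_(n + 1)) : ver (u + v) = ver u + ver v.
Proof. by rewrite -[u in LHS](@ptK R n) -[v in LHS](@ptK R n) ptD ver_pt. Qed.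

Lemma verZ a (v : 'rV[R]_(n + 1)) : ver (a *: v) = a * ver v.
Proof. by rewrite -[v in LHS](@ptK R n) ptZ ver_pt. Qed.

Lemma link_base_acyclic F : cells M F -> F !=set0 ->
  acyclic R (link (cone_cells M) (base F)).
Proof.
move=> MF F0; have [x0 [z [Fx0 tz _ oz _]]] := foot (cells_convex MF) F0.
(* This is the apex minus the foot [(z, 0)], hence orthogonal to the base face. *)
pose q : 'rV[R]_(n + 1) := pt (- z) 1.
have FpF : base F `<=` pyramid F by exact: base_pyramid.
(* The link before normalization. Pyramids suffice as cells, because [base G] lies in
   [pyramid G]. *)
pose D : set 'rV[R]_(n + 1) := [set y | [/\ y != 0, orth (base F) y &
  exists G, [/\ cells M G, F `<=` G & tangent (base F) (pyramid G) y]]].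
have linkD v : link (cone_cells M) (base F) v -> dotp v v = 1 /\ D v.
  move=> /linkP[v1 ov [_ [[[G MG <-]|[G MG <-]] FG tv]]]; split=> //;
    (split; [exact: unit_neq0| by []|exists G; split=> //]).
  - exact/base_sub.
  - by apply: tangent_mono tv => //; exact: base_pyramid.
  - exact/base_sub_pyramid.
have tq : tangent (base F) (pyramid F) q.
  have -> : q = (apex R n - pt x0 0) + pt (x0 - z) 0.
    by rewrite ptB ptD sub0r subr0 addr0 addrA addNr sub0r.
  apply: tangent_add; [exact: base_convex|exact: pyramid_convex| |].
    by apply: tangent_sub; [exact/base_pt|exact: pyramid_apex].
  by apply: tangent_mono (tangent_base tz).
have oq : orth (base F) q.
  move=> _ _ /baseP[x Fx ->] /baseP[y Fy ->].
  by rewrite ptB subrr dotp_pt mulr0 addr0 dotpNl oz // oppr0.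
have q0 : q != 0.
  by apply/eqP => /(congr1 (@ver R n)) /eqP; rewrite ver_pt /ver !mxE oner_eq0.
have Dq : D q by split=> //; exists F; split.
apply: (@star_acyclic R (n + 1) _ D (@normalize R (n + 1)) q 1).
- by move=> v /linkD[v1 _]; exact: normalize_unit.
- move=> y [y0 _ _].
  by apply: (@cvg_normalize _ _ _ (nbhs y) _ id y y0); exact: cvg_id.
- move=> y [y0 oy [G [MG FG ty]]]; apply/linkP; split.
  + exact: dotp_normalize.
  + exact: orth_scale.
  + exists (pyramid G); split; first by right; exists G.
      exact/base_sub_pyramid.
    exact/tangent_scale/ty/normalize_coef.
- exact: Dq.
- move=> v s /linkD[v1 [v0 ov [G [MG FG tv]]]] /andP[s0 s1].
  have tqG : tangent (base F) (pyramid G) q.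
    by apply: tangent_mono tq => //; exact: pyramid_sub.
  have [s00|s00] := eqVneq s 0.
    by rewrite s00 scale0r add0r subr0 scale1r; split=> //; exists G.
  have [s11|s11] := eqVneq s 1.
    by rewrite s11 subrr scale0r addr0 scale1r.
  have sp : 0 < s by rewrite lt_neqAle eq_sym s00.
  have sp1 : 0 < 1 - s by rewrite subr_gt0 lt_neqAle s11.
  split.
  (* The segment avoids 0: tangent directions at the base have height at least 0 and [q] has height
     1, so the height is positive as soon as [s] is. *)
  + have hv : 0 <= ver v.
      have [_ [t [/baseP[x Fx ->] t0 /ver_pyramid_ge0]]] := tv.
      by rewrite verD verZ ver_pt add0r pmulr_rge0.
    apply/eqP => /(congr1 (@ver R n)).
    by rewrite verD !verZ ver_pt mulr1 {2}/ver !mxE => e; nra.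
  + by apply: orth_add; exact: orth_scale.
  + exists G; split=> //; apply: tangent_add;
      [exact: base_convex|exact: pyramid_convex| |]; exact: tangent_scale.
- by move=> v /linkD[v1 _]; exact: unit_norm_le1.
Qed.

(** Besides orthogonality to [F], a single condition remains: orthogonality to the direction
    [(z, -1)] from the apex to the foot. *)
Lemma orth_pyramid F z v : F !=set0 ->
  (forall w x, orth F w -> F x -> dotp w x = dotp w z) ->
  (orth (pyramid F) v <-> orth F (hor v) /\ dotp (hor v) z = ver v).
Proof.
move=> [x0 Fx0] Fz; rewrite -{1}[v]ptK; set u := hor v; set h := ver v; split.
  move=> ov; have ou : orth F u.
    move=> x y Fx Fy; have := ov (pt x 0) (pt y 0).
    rewrite ptB subrr dotp_pt mulr0 addr0; apply; exact/pyramid0.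
  split=> //; have := ov (apex R n) (pt x0 0) (pyramid_apex F).
  rewrite ptB dotp_pt sub0r subr0 mulr1 dotpNr (Fz _ _ ou Fx0) => e.
  have /e/eqP : pyramid F (pt x0 0) by exact/pyramid0.
  by rewrite addrC subr_eq0 => /eqP.
move=> [ou uz].
suff const P : pyramid F P -> dotp (pt u h) P = h.
  by move=> P Q /const FP /const FQ; rewrite dotpDr dotpNr FP FQ subrr.
move=> [->|[x [s [Fx _ ->]]]]; rewrite dotp_pt.
  by rewrite dotpC dotp0l add0r mulr1.
by rewrite dotpZr (Fz _ _ ou Fx) uz; ring.
Qed.

(** The pyramid adds the line spanned by [(z, -1)] to the directions of [F]. Orthogonal projection
    along this line is [phi], and [psi] projects along it back to height 0. Both preserve tangency,
    as the line is tangent to the pyramid in both senses. *)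
Lemma link_pyramid_homeo F : cells M F -> F !=set0 ->
  exists f g, set_homeo (link (cells M) F) (link (cone_cells M) (pyramid F)) f g.
Proof.
move=> MF F0; have [x0 [z [Fx0 tz tNz oz Fz]]] := foot (cells_convex MF) F0.
have op v := orth_pyramid v F0 Fz.
(* Modulo the directions of the pyramid over [F], [phi w] is [(w, 0)]; its last
   coordinate is chosen to make it orthogonal to that pyramid. *)
pose h (w : 'rV[R]_n) := dotp w z / (1 + dotp z z).
have z1 : 0 < 1 + dotp z z by rewrite ltr_pwDl // dotp_ge0.
have hE w : h w * (1 + dotp z z) = dotp w z by rewrite divfK // gt_eqF.
have hZ c w : h (c *: w) = c * h w by rewrite /h dotpZl mulrA.
pose phi (w : 'rV[R]_n) : 'rV[R]_(n + 1) := pt (w - h w *: z) (h w).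
pose psi (v : 'rV[R]_(n + 1)) : 'rV[R]_n := hor v + ver v *: z.
have phiK w : psi (phi w) = w by rewrite /psi hor_pt ver_pt subrK.
have phiZ c w : phi (c *: w) = c *: phi w by rewrite /phi ptZ hZ scalerBr scalerA.
have psiZ c v : psi (c *: v) = c *: psi v.
  by rewrite /psi verZ -{1}[v]ptK ptZ hor_pt scalerDr scalerA.
have psiK v : dotp (hor v) z = ver v -> phi (psi v) = v.
  move=> uz; have hv : h (psi v) = ver v.
    apply: (mulIf (lt0r_neq0 z1)); rewrite hE /psi dotpDl uz dotpZl; ring.
  by rewrite /phi hv addrK ptK.
have phic (T : Type) (D : set_system T) (FD : Filter D) (f : T -> 'rV[R]_n) a :
    f @ D --> a -> phi (f t) @[t --> D] --> phi a.
  move=> fa; have hc : h (f t) @[t --> D] --> h a.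
    by apply: cvgM; [apply: cvg_dotp => //; exact: cvg_cst|exact: cvg_cst].
  by apply: cvg_pt => //; apply: cvgB => //; exact: cvgZr_tmp.
have psic (T : Type) (D : set_system T) (FD : Filter D)
    (f : T -> 'rV[R]_(n + 1)) a :
    f @ D --> a -> psi (f t) @[t --> D] --> psi a.
  by move=> fa; apply: cvgD; [exact: cvg_hor|apply: cvgZr_tmp; exact: cvg_ver].
have phi0 w : w != 0 -> phi w != 0.
  apply: contra_neq => p0; rewrite -(phiK w) p0.
  by rewrite -(scale0r (0 : 'rV[R]_(n + 1))) psiZ scale0r.
have psi0 v : dotp (hor v) z = ver v -> v != 0 -> psi v != 0.
  move=> uz; apply: contra_neq => p0; rewrite -(psiK v uz) p0.
  by rewrite -(scale0r (0 : 'rV[R]_n)) phiZ scale0r.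
have tanphi G w : cells M G -> F `<=` G -> tangent F G w ->
    tangent (pyramid F) (pyramid G) (phi w).
  move=> MG FG tw; have pFG := pyramid_sub FG.
  have tb u : tangent F G u -> tangent (pyramid F) (pyramid G) (pt u 0).
    move=> /tangent_base; apply: tangent_mono; exact: base_pyramid.
  have pF0 : pyramid F !=set0 by exists (apex R n); exact: pyramid_apex.
  have cpF := pyramid_convex MF; have cpG := pyramid_convex MG.
  (* The apex minus the foot is split into the apex minus [x0] and a horizontal direction of [F];
     both parts and their opposites are tangent, so the sign of [h w] does not matter. *)
  have -> : phi w = pt w 0 + h w *: ((apex R n - pt x0 0) + pt (x0 - z) 0).
    rewrite ptB ptD ptZ ptD /phi sub0r subr0 !addr0 addrA addNr sub0r mulr1 add0r.
    by rewrite scalerN.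
  apply: tangent_add => //; first exact: tb.
  apply: tangent_scaleR => //.
    apply: tangent_add => //.
      by apply: tangent_sub; [exact/pyramid0|exact: pyramid_apex].
    by apply: tb; apply: tangent_mono tz.
  rewrite opprD opprB [- pt (x0 - z) 0]ptN oppr0 opprB; apply: tangent_add => //.
    by apply: tangent_sub; [exact: pyramid_apex|exact/pyramid0/FG].
  by apply: tb; apply: tangent_mono tNz.
have tanpsi G v : cells M G -> F `<=` G -> tangent (pyramid F) (pyramid G) v ->
    tangent F G (psi v).
  move=> MG FG [P [t [FP t0 GP]]].
  have cF := cells_convex MF; have cG := cells_convex MG.
  have tR c u : tangent F G u -> tangent F G (- u) -> tangent F G (c *: u).
    exact: tangent_scaleR.
  have z2 : tangent F G 0.
    by rewrite -(subrr x0); apply: tangent_sub => //; exact: FG.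
  have tge c u : 0 <= c -> tangent F G u -> tangent F G (c *: u).
    rewrite le_eqVlt => /orP[/eqP<- _|c0]; first by rewrite scale0r.
    exact: tangent_scale.
  (* The vector [hor P' + (ver P' - 1) *: x0] projects [P'] minus the apex to height 0 along the
     line joining [x0] to the apex; for a point over [x] it equals [(1 - s) *: (x - x0)]. *)
  have parF P' : pyramid F P' -> tangent F G (- (hor P' + (ver P' - 1) *: x0)).
    move=> [->|[x [s [Fx /andP[s0 s1] ->]]]]; rewrite hor_pt ver_pt.
      by rewrite subrr scale0r addr0 oppr0.
    have -> : - ((1 - s) *: x + (s - 1) *: x0) = (1 - s) *: (x0 - x).
      by rewrite scalerBr opprD -[- ((s - 1) *: x0)]scaleNr opprB addrC.
    by apply: tge; [rewrite subr_ge0|apply: tangent_sub => //; exact: FG].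
  have parG P' : pyramid G P' -> tangent F G (hor P' + (ver P' - 1) *: x0).
    move=> [->|[x [s [Gx /andP[s0 s1] ->]]]]; rewrite hor_pt ver_pt.
      by rewrite subrr scale0r addr0.
    have -> : (1 - s) *: x + (s - 1) *: x0 = (1 - s) *: (x - x0).
      by rewrite scalerBr -scaleNr opprB.
    by apply: tge; [rewrite subr_ge0|apply: tangent_sub].
  (* Projecting along the line through [x0] instead of [z] changes the result by a multiple of
     [z - x0], which is tangent with either sign. *)
  have -> : psi v = t^-1 *: ((hor (P + t *: v) + (ver (P + t *: v) - 1) *: x0) -
      (hor P + (ver P - 1) *: x0)) + ver v *: (z - x0).
    rewrite -[P]ptK -[v]ptK; move: (hor P) (ver P) (hor v) (ver v) => a b u k.
    rewrite ptZ ptD /psi !hor_pt !ver_pt.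
    have -> : a + t *: u + (b + t * k - 1) *: x0 - (a + (b - 1) *: x0) =
        t *: (u + k *: x0).
      rewrite opprD addrACA [a + _]addrC addrK -scalerBl scalerDr scalerA.
      by congr (_ + _ *: _); ring.
    by rewrite scalerA mulVf ?gt_eqF // scale1r scalerBr addrACA subrr addr0.
  apply: tangent_add => //; last first.
    apply: tR; first exact: tangent_mono tNz.
    by rewrite opprB; exact: tangent_mono tz.
  apply: tangent_scale; first by rewrite invr_gt0.
  by apply: tangent_add => //; [exact: parG|exact: parF].
exists (fun w => normalize (phi w)), (fun v => normalize (psi v)); split.
- move=> w /linkP[w1 ow [G [MG FG tw]]].
  have w0 := phi0 _ (unit_neq0 w1); have c0 := normalize_coef w0; split.
  + apply/linkP; split; first exact: dotp_normalize.
      apply: orth_scale; apply/op; rewrite hor_pt ver_pt; split.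
        by rewrite -scaleNr; apply: orth_add => //; exact: orth_scale.
      by rewrite dotpDl dotpNl dotpZl -hE; ring.
    exists (pyramid G); split; [by right; exists G|exact: pyramid_sub|].
    exact/tangent_scale/tanphi.
  + by rewrite [normalize (phi w)]/normalize psiZ phiK normalizeZ.
  + apply: (@cvg_normalize _ _ _ (nbhs w) (nbhs_filter w) phi _ w0).
    exact: (phic _ _ (nbhs_filter w) id w cvg_id).
- move=> v /linkP[v1 /op[ou uz] [_ [[[G MG <-]|[G MG <-]] FG tv]]].
    by case: (pyramid_base FG).
  have {}FG := pyramid_sub_inv FG.
  have v0 := psi0 _ uz (unit_neq0 v1); have c0 := normalize_coef v0; split.
  + apply/linkP; split; first exact: dotp_normalize.
      by apply: orth_scale; apply: orth_add => //; exact: orth_scale.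
    by exists G; split=> //; exact/tangent_scale/tanpsi.
  + by rewrite [normalize (psi v)]/normalize phiZ psiK // normalizeZ.
  + apply: (@cvg_normalize _ _ _ (nbhs v) (nbhs_filter v) psi _ v0).
    exact: (psic _ _ (nbhs_filter v) id v cvg_id).
Qed.

(** Central projection: the direction from the apex to [(y, 0)] is [(y, -1)], and rescaling a link
    vector to last coordinate -1 recovers [y]. *)
Lemma link_apex_homeo : exists f g,
  set_homeo (underlying (cells M)) (link (cone_cells M) (pyramid set0)) f g.
Proof.
have n0 (y : 'rV[R]_n) : pt y (- 1) != 0 :> 'rV[R]_(n + 1).
  apply/eqP => /(congr1 (@ver R n)) /eqP; rewrite ver_pt /ver !mxE oppr_eq0.
  by rewrite oner_eq0.
have fc (T : Type) (D : set_system T) (FD : Filter D) (f : T -> 'rV[R]_n) a :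
    f @ D --> a -> normalize (pt (f t) (- 1)) @[t --> D] --> normalize (pt a (- 1)).
  move=> fa; apply: cvg_normalize; first exact: n0.
  by apply: cvg_pt => //; exact: cvg_cst.
have gc (T : Type) (D : set_system T) (FD : Filter D)
    (f : T -> 'rV[R]_(n + 1)) a :
    - ver a != 0 -> f @ D --> a ->
    (- ver (f t))^-1 *: hor (f t) @[t --> D] --> (- ver a)^-1 *: hor a.
  move=> a0 fa; apply: cvgZ; last exact: cvg_hor.
  by apply: cvgV => //; apply: cvgN; exact: cvg_ver.
exists (fun y => normalize (pt y (- 1))), (fun v => (- ver v)^-1 *: hor v); split.
- move=> y [G MG Gy]; have c0 := normalize_coef (n0 y); split.
  + apply/linkP; split; first exact: dotp_normalize.
      by move=> a b [->|[? [? []]]//] [->|[? [? []]]//]; rewrite subrr dotpC dotp0l.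
    exists (pyramid G); split; [by right; exists G|by apply: pyramid_sub|].
    apply: tangent_scale => //.
    have -> : pt y (- 1) = pt y 0 - apex R n by rewrite ptB subr0 sub0r.
    by apply: tangent_sub; [exact: pyramid_apex|exact/pyramid0].
  + rewrite /normalize; move: (_^-1) c0 => c c0; rewrite ptZ ver_pt hor_pt.
    by rewrite mulrN1 opprK scalerA mulVf ?scale1r // gt_eqF.
  + exact: (fc _ _ (nbhs_filter y) id y cvg_id).
- move=> v /linkP[v1 _ [_ [[[G MG <-]|[G MG <-]] FG tv]]].
    by case: (pyramid_base FG).
  (* Points of the pyramid other than the apex lie strictly below it, so a link vector has negative
     height. *)
  have [y [k [Gy k0 vy]]] : exists y k, [/\ G y, 0 < k & v = k *: pt y (- 1)].
    have [_ [t [[->|[? [? []]]//] t0 Pv]]] := tv.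
    have vE P : v = t^-1 *: (P - apex R n) \/ P <> apex R n + t *: v.
      have [->|/eqP] := eqVneq P (apex R n + t *: v); last by right.
      by left; rewrite addrC addKr scalerA mulVf ?scale1r ?gt_eqF.
    case: Pv => [e|[y [s [Gy /andP[s0 s1] e]]]].
      have := unit_neq0 v1; have [->|/(_ (esym e))//] := vE (apex R n).
      by rewrite subrr scaler0 eqxx.
    have [v2|/(_ (esym e))//] := vE (pt ((1 - s) *: y) s).
    have {}v2 : v = (t^-1 * (1 - s)) *: pt y (- 1).
      by rewrite v2 ptB subr0 -scalerA [in RHS]ptZ mulrN1 opprB.
    exists y, (t^-1 * (1 - s)); split=> //.
    rewrite mulr_gt0 ?invr_gt0 // subr_gt0 lt_neqAle s1 andbT.
    by apply: contra_neq (unit_neq0 v1) => e1; rewrite v2 e1 subrr mulr0 scale0r.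
  have gv : (- ver v)^-1 *: hor v = y.
    by rewrite vy ptZ ver_pt hor_pt mulrN1 opprK scalerA mulVf ?gt_eqF // scale1r.
  split.
  + by rewrite gv; exists G.
  + rewrite gv; have -> : pt y (- 1) = k^-1 *: v.
      by rewrite vy scalerA mulVf ?scale1r // gt_eqF.
    by rewrite normalizeZ // invr_gt0.
  + apply: (gc _ _ (nbhs_filter v) id v _ cvg_id).
    by rewrite vy ptZ ver_pt mulrN1 opprK gt_eqF.
Qed.

End ConeLinks.

(** * Assembling the homology ball *)

Lemma underlying_bounded (R : realType) n (C : set (set 'rV[R]_n)) :
  finite_set C -> (forall P, C P -> polytope P) ->
  exists K, forall x, underlying C x -> `|x| <= K.
Proof.
move=> /finite_seqP[s ->] Cp.
have {}Cp P : P \in s -> polytope P by move=> /Cp.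
suff [K Ks] : exists K, forall P x, P \in s -> P x -> `|x| <= K.
  by exists K => x [P /= Ps Px]; exact: Ks Px.
elim: s Cp => [|P s IHs] Cp; first by exists 0.
have [Q Qs|K Ks] := IHs _; first by apply: Cp; rewrite inE Qs orbT.
have [L PL] := polytope_bounded (Cp P (mem_head P s)).
exists (Num.max K L) => Q x; rewrite inE => /orP[/eqP->|Qs] Qx; rewrite le_max.
  by rewrite PL ?orbT.
by rewrite (Ks Q).
Qed.

(** Purity is applied to the empty cell, which every complex has. *)
Lemma manifold_top_cell (R : realType) n d (M : polycomplex R n) :
  homology_manifold M d -> exists G, [/\ cells M G, G !=set0 & dim G = d].
Proof.
by move=> [/(_ _ (cells_empty M))[_ [G [MG _ G0 Gd]]] _]; exists G.
Qed.

Lemma dim_base_le (R : realType) n d (M : polycomplex R n) F :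
  homology_manifold M d -> cells M F -> (dim (base F) <= d)%N.
Proof.
move=> [pM _] MF; have [F0|/set0P F0] := eqVneq F set0.
  by rewrite F0 /base image_set0 dim_set0.
by rewrite dim_base //; case: (pM _ MF).
Qed.

Theorem theorem5p4 (R : realType) (n d : nat) (M : polycomplex R n)
    (hM : homology_manifold M d) (hacyclic : vanishing_homology M) :
  exists (m : nat) (B : polycomplex R (n + m)) (e : nat),
    homology_ball B e /\
    full_dim_subcomplex (embed m (cells M)) (boundary B e).
Proof.
have [pM lM] := hM.
have [G0 [MG0 G00 G0d]] := manifold_top_cell hM.
have baseM F : cells M F -> cone_cells M (base F) by left; exists F.
have pyrM F : cells M F -> cone_cells M (pyramid F) by right; exists F.
have base0 F : base F !=set0 -> F !=set0 by move=> [_ /baseP[x Fx _]]; exists x.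
have dimp F : cells M F -> F !=set0 -> (dim (pyramid F) <= d + 1)%N.
  by move=> MF F0; rewrite dim_pyramid // leq_add2r; case: (pM _ MF).
have linkp F k : cells M F -> F !=set0 ->
    sphere_homology R (link (cells M) F) k ->
    sphere_homology R (link (cone_cells M) (pyramid F)) k.
  move=> MF F0; have [f [g]] := link_pyramid_homeo MF F0.
  exact: set_homeo_sphere.
have baseB F : cells M F -> boundary (cone_complex M) (d + 1) (base F).
  move=> MF; split; first exact: baseM.
  by move=> /base0 F0; apply/acyclic_sphereF/link_base_acyclic.
have dimB E : boundary (cone_complex M) (d + 1) E -> (dim E <= d)%N.
  move=> [[[F MF <-]|[F MF <-]] nE]; first exact: (dim_base_le hM).
  have [F0|/set0P F0] := eqVneq F set0; first by rewrite F0 dim_pyramid0.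
  (* A pyramid of dimension [d + 1] stands over a cell of dimension [d]. The empty link of that cell
     is spherical, hence so is the link of the pyramid, which contradicts [nE]. *)
  rewrite dim_pyramid // addn1 ltnNge; apply/negP => dF.
  have {dF}dF : dim F = d by apply/eqP; rewrite eqn_leq dF andbT; case: (pM _ MF).
  have [|] := lM _ MF F0.
    rewrite link_top // => [/acyclic_neq0[x]|G MG].
      by have := set_mem (valP x).
    by rewrite dF; case: (pM _ MG).
  move=> /(linkp _ _ MF F0) sF; apply: nE.
    by exists (apex R n); exact: pyramid_apex.
  by rewrite dim_pyramid // subnDr.
have starB x s : underlying (cone_cells M) x -> 0 <= s <= 1 ->
    underlying (cone_cells M) (s *: apex R n + (1 - s) *: x).
  move=> [_ [[F MF <-]|[F MF <-]] Fx] s01; exists (pyramid F) => //;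
    try exact: pyrM.
    by apply: pyramid_star => //; exact: base_pyramid.
  exact: pyramid_star.
have apexB : underlying (cone_cells M) (apex R n).
  by exists (pyramid G0); [exact: pyrM|exact: pyramid_apex].
exists 1%N, (cone_complex M), (d + 1)%N; split; first split.
- split=> [_ [] [F MF <-]|_ [] [F MF <-] F0].
  + have [dF [G [MG FG G0' dG]]] := pM _ MF; split.
      by rewrite (leq_trans (dim_base_le hM MF)) ?leq_addr.
    exists (pyramid G); split; [exact: pyrM|exact/base_sub_pyramid| |].
      by exists (apex R n); exact: pyramid_apex.
    by rewrite dim_pyramid // dG.
  + have [dF [G [MG FG G0' dG]]] := pM _ MF; split.
      have [F0|/set0P F0] := eqVneq F set0; first by rewrite F0 dim_pyramid0.
      exact: dimp.
    exists (pyramid G); split; [exact: pyrM|exact: pyramid_sub| |].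
      by exists (apex R n); exact: pyramid_apex.
    by rewrite dim_pyramid // dG.
  + by left; apply: link_base_acyclic => //; exact: base0.
  + have [F00|/set0P F00] := eqVneq F set0.
      left; rewrite F00; have [f [g fg]] := link_apex_homeo M.
      exact: set_homeo_acyclic fg hacyclic.
    have [aF|sF] := lM _ MF F00.
      left; have [f [g fg]] := link_pyramid_homeo MF F00.
      exact: set_homeo_acyclic fg aF.
    (* The dimensions of the complex and of the face both grow by one, so the expected sphere is the
       same. *)
    by right; rewrite dim_pyramid // subnDr; exact: linkp.
- apply: (star_pi1_surjective (p := apex R n)) => // x [E [BE _] Ex].
  by exists E.
(* The cone is itself star-shaped, so [D] is the whole set and [N] the identity. *)
- have [K BK] := underlying_bounded (cone_cells_finite M)
    (@cone_cells_polytope _ _ M).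
  apply: (@star_acyclic R (n + 1) _ (underlying (cone_cells M)) id
    (apex R n) K) => //.
  by move=> y _; exact: cvg_id.
split.
  split=> [_ [F MF <-]|F _ [G MG <-]]; first exact: baseB.
  by move=> /face_base[H HG ->]; exists H => //; exact: cells_face HG.
have nbG0 : base G0 !=set0 by have [x Gx] := G00; exists (pt x 0); exact/base_pt.
have dG0 : dim (base G0) = d by rewrite dim_base.
exists d; split; split.
- by exists (base G0); split=> //; exists G0.
- by move=> _ [F MF <-]; exact: (dim_base_le hM).
- by exists (base G0); split=> //; exact: baseB.
- exact: dimB.
Qed.
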